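(* Let $l,d\in\mathbb{N}$ and let $(X_t)_{t\in\mathbb{R}^l}$ be an $\mathbb{R}^d$-valued strictly stationary infinitely divisible random field such that the Lévy measure $Q_0$ of the law $\mathcal{L}(X_0)$ satisfies $$Q_0\big(\{x=(x_1,\dots,x_d)'\in\mathbb{R}^d:\ \exists j\in\{1,\dots,d\},\ x_j\in 2\pi\mathbb{Z}\}\big)=0.$$ Then $(X_t)_{t\in\mathbb{R}^l}$ is mixing if and only if $$\lim_{n\to\infty}\mathbb{E}\big[e^{i(X_{t_n}^{(j)}-X_0^{(k)})}\big]=\mathbb{E}\big[e^{iX_0^{(j)}}\big]\cdot\mathbb{E}\big[e^{-iX_0^{(k)}}\big]$$ for all $j,k\in\{1,\dots,d\}$ and every sequence $(t_n)_{n\in\mathbb{N}}\in\mathcal{T}$.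
   Context: An $\mathbb{R}^d$-valued random field $(X_t)_{t\in\mathbb{R}^l}$ is strictly stationary if its finite-dimensional distributions are invariant under all translations of $\mathbb{R}^l$, and infinitely divisible (ID) if all its finite-dimensional distributions are infinitely divisible. $X_t^{(j)}$ denotes the $j$-th component of $X_t$. A prime denotes transposition. $\mathcal{T}:=\{(t_n)_{n\in\mathbb{N}}\subset\mathbb{R}^l:\lim_{n\to\infty}\|t_n\|_\infty=\infty\}$. A stationary field $(X_t)$ is called mixing if for all $m\in\mathbb{N}$, all $\lambda=(s_1,\dots,s_m)',\mu=(p_1,\dots,p_m)'\in\mathbb{R}^{ml}$, all $\theta_1,\theta_2\in\mathbb{R}^{md}$ and all $(t_n)\in\mathcal{T}$, $$\lim_{n\to\infty}\mathbb{E}\big[\exp(i\langle\theta_1,X_\lambda\rangle+i\langle\theta_2,X_{\tilde\mu_n}\rangle)\big]=\mathbb{E}\big[\exp(i\langle\theta_1,X_\lambda\rangle)\big]\,\mathbb{E}\big[\exp(i\langle\theta_2,X_\mu\rangle)\big],$$ where $X_\lambda:=(X_{s_1}',\dots,X_{s_m}')'\in\mathbb{R}^{md}$ and $\tilde\mu_n=(p_1+t_n,\dots,p_m+t_n)'$. *)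

(* Defs.v *)
From HB Require Import structures.
From mathcomp Require Import all_boot all_order all_algebra.
From mathcomp Require Import all_classical all_reals all_analysis.
From mathcomp Require Export complex.

Set Implicit Arguments.
Unset Strict Implicit.
Unset Printing Implicit Defensive.

Import Order.TTheory GRing.Theory Num.Theory.
Import numFieldNormedType.Exports.

Local Open Scope classical_set_scope.
Local Open Scope ring_scope.
Local Open Scope complex_scope.

(* The sigma-algebra on row vectors is the product one, as for [n.-tuple T] in
   MathComp-Analysis; on ['rV[R]_n] with [R] real it is the Borel one. *)
Section measurable_rV.
Context {disp : measure_display} {T : sigmaRingType disp}.
Variable n : nat.

Let coord : 'I_n -> 'rV[T]_n -> T := fun j x => x ord0 j.

Let rV_set0 : g_sigma_preimage coord set0.
Proof. exact: sigma_algebra0. Qed.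

Let rV_setC A : g_sigma_preimage coord A -> g_sigma_preimage coord (~` A).
Proof. exact: sigma_algebraC. Qed.

Let rV_bigcup (F : (set 'rV[T]_n)^nat) :
  (forall i, g_sigma_preimage coord (F i)) ->
  g_sigma_preimage coord (\bigcup_i (F i)).
Proof. exact: sigma_algebra_bigcup. Qed.

HB.instance Definition _ := @isMeasurable.Build (measure_tuple_display disp)
  'rV[T]_n (g_sigma_preimage coord) rV_set0 rV_setC rV_bigcup.

End measurable_rV.

Definition dotv (R : realType) (n : nat) (x y : 'rV[R]_n) : R :=
  \sum_(j < n) x ord0 j * y ord0 j.

Definition cexp (R : realType) (z : R[i]) : R[i] :=
  (expR (complex.Re z))%:C * (cos (complex.Im z) +i* sin (complex.Im z)).

Definition cintegral (R : realType) (disp : measure_display)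
    (T : measurableType disp) (mu : {measure set T -> \bar R})
    (f : T -> R[i]) : R[i] :=
  (\int[mu]_x complex.Re (f x)) +i* (\int[mu]_x complex.Im (f x)).

(* [C^o] carries the topology of the modulus. *)
Definition ccvg (R : realType) (u : nat -> R[i]) (z : R[i]) : Prop :=
  (u : nat -> R[i]^o) @ \oo --> (z : R[i]^o).

Definition charfun (R : realType) (n : nat) (mu : probability 'rV[R]_n R)
    (theta : 'rV[R]_n) : R[i] :=
  cintegral mu (fun x => cexp ('i%C * (dotv theta x)%:C)).

(* (mu * nu)(B) = \int nu(B - x) mu(dx) *)
Definition convolution (R : realType) (n : nat) (mu : probability 'rV[R]_n R)
    (nu : set 'rV[R]_n -> \bar R) : set 'rV[R]_n -> \bar R :=
  fun B => (\int[mu]_x nu [set y | B (x + y)%R])%E.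

(* [iter k (convolution rho) rho] is the (k+1)-fold convolution of rho. *)
Definition infinitely_divisible (R : realType) (n : nat)
    (mu : set 'rV[R]_n -> \bar R) : Prop :=
  forall k : nat, exists rho : probability 'rV[R]_n R,
    forall B : set 'rV[R]_n, measurable B ->
      mu B = iter k (convolution rho) rho B.

(* Norms on R^n are Euclidean here: |x|^2 = <x, x>. *)
Definition levy_integrable (R : realType) (n : nat)
    (Q : {measure set 'rV[R]_n -> \bar R}) : Prop :=
  Q [set 0] = 0%E /\
  (\int[Q]_x (Num.min 1 (dotv x x))%:E < +oo)%E.

Definition levy_exponent (R : realType) (n : nat) (gamma : 'rV[R]_n)
    (Sigma : 'M[R]_n) (Q : {measure set 'rV[R]_n -> \bar R})
    (theta : 'rV[R]_n) : R[i] :=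
  'i%C * (dotv theta gamma)%:C - (2^-1 * dotv (theta *m Sigma) theta)%:C
  + cintegral Q (fun x => cexp ('i%C * (dotv theta x)%:C) - 1
      - 'i%C * (if dotv x x <= 1 then dotv theta x else 0)%:C).

(* Q does not depend on the truncation function used in the exponent: changing
   the latter only changes gamma. *)
Definition is_levy_measure (R : realType) (n : nat)
    (mu : probability 'rV[R]_n R)
    (Q : {measure set 'rV[R]_n -> \bar R}) : Prop :=
  levy_integrable Q /\
  exists (gamma : 'rV[R]_n) (Sigma : 'M[R]_n),
    [/\ Sigma^T = Sigma,
        forall theta : 'rV[R]_n, 0 <= dotv (theta *m Sigma) theta &
        forall theta : 'rV[R]_n,
          charfun mu theta = cexp (levy_exponent gamma Sigma Q theta)].

Section random_fields.
Context (R : realType) (disp : measure_display) (Omega : measurableType disp).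
Context (P : probability Omega R) (l d : nat).
Implicit Type X : 'rV[R]_l -> {RV P >-> 'rV[R]_d}.

(* (X_{s_1}', ..., X_{s_m}')' as a vector of R^{md} *)
Definition stack X (m : nat) (s : 'I_m -> 'rV[R]_l) (w : Omega) :
    'rV[R]_(m * d) :=
  mxvec (\matrix_(a < m, j < d) X (s a) w ord0 j).

Definition fdd X (m : nat) (s : 'I_m -> 'rV[R]_l) :
    set 'rV[R]_(m * d) -> \bar R :=
  pushforward P (stack X s).

Definition strictly_stationary X : Prop :=
  forall (m : nat) (s : 'I_m -> 'rV[R]_l) (h : 'rV[R]_l)
    (B : set 'rV[R]_(m * d)),
    measurable B -> fdd X (fun a => s a + h) B = fdd X s B.

Definition infinitely_divisible_field X : Prop :=
  forall (m : nat) (s : 'I_m -> 'rV[R]_l), infinitely_divisible (fdd X s).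

(* MathComp-Analysis' norm on matrices is the sup norm. *)
Definition escaping (t : nat -> 'rV[R]_l) : Prop :=
  (fun n => `|t n|) @ \oo --> +oo.

Definition mixing X : Prop :=
  forall (m : nat) (s p : 'I_m -> 'rV[R]_l) (theta1 theta2 : 'rV[R]_(m * d))
    (t : nat -> 'rV[R]_l), escaping t ->
    ccvg
      (fun n => cintegral P (fun w =>
        cexp ('i%C * (dotv theta1 (stack X s w))%:C
              + 'i%C * (dotv theta2 (stack X (fun a => p a + t n) w))%:C)))
      (cintegral P (fun w => cexp ('i%C * (dotv theta1 (stack X s w))%:C))
       * cintegral P (fun w => cexp ('i%C * (dotv theta2 (stack X p w))%:C))).

End random_fields.

(* Main.v *)
(* The pair (X_s, X_{t+p}) is infinitely divisible, so its characteristic function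
   is the n-th power of one, phi_n, of a law rho_n, and expanding
   n (|phi_n|^2 - 1) as n tends to infinity turns every nonnegative trigonometric
   polynomial vanishing at 0 into an inequality for psi = - ln |phi|^2. This
   positivity replaces the Levy-Khintchine representation of the joint law.

   Since the variables e^{i X_t^(j)} - E e^{i X_0^(j)} have norm bounded and
   correlations vanishing at infinity, by Bessel's inequality they tend weakly to
   0 in L^2. Testing against e^{iv} and e^{-iv}, v a linear functional of the
   field at fixed times, and adding the two, the mass
   int (1 - cos x_j) (1 - cos v) dQ of the joint Levy measure Q tends to 0, the
   Gaussian covariance cancelling. As Q_0 does not charge x_j in 2 pi Z, the
   marginal bound makes int (1 - cos <theta, x>) (1 - cos v) dQ vanish as well.
   Hence theta |-> psi(theta) + psi(v) - psi(theta + v) is asymptotically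
   additive; it vanishes for theta = e_j and is equicontinuous at 0, thus it
   vanishes for all theta, which controls the modulus of the joint
   characteristic function. Its phase is controlled at the level of rho_n, where
   it is O(1/n). *)

Require Import Defs.
From mathcomp Require Import all_boot all_order all_algebra.
From mathcomp Require Import all_classical all_reals all_analysis.
From mathcomp Require Import measurable_realfun.
From mathcomp Require Import ring lra.
Set Implicit Arguments.
Unset Strict Implicit.
Unset Printing Implicit Defensive.

Import Order.TTheory GRing.Theory Num.Theory.
Import numFieldNormedType.Exports.

Local Open Scope classical_set_scope.
Local Open Scope ring_scope.
Local Open Scope complex_scope.

(** * Measurability and expectations of bounded functions *)

(** The obstacle is that only the one-point law comes with a Levy measure. All that is known of the
    laws of (X_s, X_{t+p}), which change with t, is that they have convolution roots of every order.
    Each estimate of a Levy integral must therefore be an inequality between finitely many values of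
    psi. Stationarity makes psi at purely fixed or purely moving frequencies independent of t, so
    every AM-GM parameter eta can be fixed before t escapes.

    The marginal bound rests on (1 - cos <theta, x>)^2 ((1 + cos x_j) / 2)^k. The power isolates the
    lattice x_j in 2 pi Z; off the lattice, Bernoulli's inequality brings in 1 - cos x_j. The square
    makes the function vanish to fourth order at 0, which removes the Gaussian part.

    Controlling the phase through a logarithm of phi would require a choice of branch. For rho_n, an
    imaginary part after rotation by a unit serves instead, and |z^n - w^n| <= n |z - w| on the unit
    disc carries the estimate over to phi. *)

Section measurable_row_vectors.
Context (R : realType).

Lemma measurable_coord n (i : 'I_n) :
  measurable_fun [set: 'rV[R]_n] (fun x : 'rV[R]_n => x ord0 i).
Proof.
move=> _ Y mY; rewrite setTI; apply: sub_sigma_algebra => /=.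
rewrite -bigcup_seq/=; exists i => /=; first by rewrite mem_index_enum.
by exists Y => //; rewrite setTI.
Qed.

Lemma measurable_fun_rV d (T : measurableType d) n (f : T -> 'rV[R]_n) :
  (forall i, measurable_fun [set: T] (fun w => f w ord0 i)) ->
  measurable_fun [set: T] f.
Proof.
move=> mf.
suff : g_sigma_preimage (fun i => (fun x : 'rV[R]_n => x ord0 i) \o f)
    `<=` measurable.
  rewrite g_sigma_preimage_comp => prefS _ A mA.
  by apply: prefS; exists A.
apply: smallest_sub; first exact: sigma_algebra_measurable.
move=> B; rewrite -bigcup_seq => -[i _ [A mA <-]].
exact: mf.
Qed.

Lemma measurable_dotv n (theta : 'rV[R]_n) :
  measurable_fun [set: 'rV[R]_n] (dotv theta).
Proof.
apply: measurable_sum => i; apply: measurable_funM => //.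
exact: measurable_coord.
Qed.

End measurable_row_vectors.

Section expectation_bounded.
Context (R : realType) (d : measure_display) (T : measurableType d).

(** These functions form an algebra, and each is integrable for every probability, so that
    expectations can be rearranged without separate integrability arguments. *)
Definition bounded_measurable (f : T -> R) :=
  measurable_fun [set: T] f /\ exists M, forall x, `|f x| <= M.

Implicit Types f g : T -> R.

Lemma bmC (c : R) : bounded_measurable (fun=> c).
Proof. by split => //; exists `|c|. Qed.

Lemma bmD f g : bounded_measurable f -> bounded_measurable g ->
  bounded_measurable (fun x => f x + g x).
Proof.
move=> [mf [M fM]] [mg [N gN]]; split; first exact: measurable_funD.
by exists (M + N) => x; rewrite (le_trans (ler_normD _ _))// lerD.
Qed.

Lemma bmM f g : bounded_measurable f -> bounded_measurable g ->
  bounded_measurable (fun x => f x * g x).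
Proof.
move=> [mf [M fM]] [mg [N gN]]; split; first exact: measurable_funM.
by exists (M * N) => x; rewrite normrM ler_pM.
Qed.

Lemma bmN f : bounded_measurable f -> bounded_measurable (fun x => - f x).
Proof.
move=> bf; have := bmM (bmC (-1)) bf.
by congr bounded_measurable; apply/funext => x; rewrite mulN1r.
Qed.

Lemma bmB f g : bounded_measurable f -> bounded_measurable g ->
  bounded_measurable (fun x => f x - g x).
Proof. by move=> bf bg; apply: bmD => //; exact: bmN. Qed.

Lemma bm_norm f : bounded_measurable f ->
  bounded_measurable (fun x => `|f x|).
Proof.
move=> [mf [M fM]]; split; first exact: measurableT_comp.
by exists M => x; rewrite normr_id.
Qed.

Lemma bm_sum (I : Type) (r : seq I) (F : I -> T -> R) :
  (forall i, bounded_measurable (F i)) ->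
  bounded_measurable (fun x => \sum_(i <- r) F i x).
Proof.
move=> bF; elim: r => [|i r IH].
  by under eq_fun do rewrite big_nil; exact: bmC.
by under eq_fun do rewrite big_cons; apply: bmD.
Qed.

Lemma bm_cos f : measurable_fun [set: T] f ->
  bounded_measurable (fun x => cos (f x)).
Proof.
move=> mf; split; last by exists 1 => x; exact: cos_max.
apply: measurableT_comp => //; apply: continuous_measurable_fun.
exact: continuous_cos.
Qed.

Lemma bm_sin f : measurable_fun [set: T] f ->
  bounded_measurable (fun x => sin (f x)).
Proof.
move=> mf; split; last by exists 1 => x; exact: sin_max.
apply: measurableT_comp => //; apply: continuous_measurable_fun.
exact: continuous_sin.
Qed.

Variable P : probability T R.

Lemma bm_integrable f : bounded_measurable f ->
  P.-integrable [set: T] (EFin \o f).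
Proof.
move=> [mf [M fM]]; apply: measurable_bounded_integrable => //.
  by rewrite (le_lt_trans (probability_le1 P _))// ltry.
exists M; split; first exact: num_real.
by move=> y My x _; apply: le_trans (fM x) _; exact: ltW.
Qed.

Lemma ERD f g : bounded_measurable f -> bounded_measurable g ->
  \int[P]_x (f x + g x) = \int[P]_x f x + \int[P]_x g x.
Proof. by move=> bf bg; rewrite RintegralD//; exact: bm_integrable. Qed.

Lemma ERB f g : bounded_measurable f -> bounded_measurable g ->
  \int[P]_x (f x - g x) = \int[P]_x f x - \int[P]_x g x.
Proof. by move=> bf bg; rewrite RintegralB//; exact: bm_integrable. Qed.

Lemma ERZ c f : bounded_measurable f ->
  \int[P]_x (c * f x) = c * \int[P]_x f x.
Proof. by move=> bf; rewrite RintegralZl//; exact: bm_integrable. Qed.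

Lemma ERC c : \int[P]_x c = c.
Proof.
by rewrite Rintegral_cst// [X in fine X]probability_setT mulr1.
Qed.

Lemma ER_le f g : bounded_measurable f -> bounded_measurable g ->
  (forall x, f x <= g x) -> \int[P]_x f x <= \int[P]_x g x.
Proof. by move=> bf bg fg; apply: le_Rintegral => //; exact: bm_integrable. Qed.

Lemma ER_sum (I : Type) (r : seq I) (F : I -> T -> R) :
  (forall i, bounded_measurable (F i)) ->
  \int[P]_x (\sum_(i <- r) F i x) = \sum_(i <- r) \int[P]_x F i x.
Proof.
move=> bF; elim: r => [|i r IH].
  by under eq_Rintegral do rewrite big_nil; rewrite ERC big_nil.
under eq_Rintegral do rewrite big_cons.
by rewrite ERD ?IH ?big_cons//; exact: bm_sum.
Qed.

Lemma ER_norm f : bounded_measurable f ->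
  `|\int[P]_x f x| <= \int[P]_x `|f x|.
Proof. by move=> bf; apply: le_normr_Rintegral => //; exact: bm_integrable. Qed.

End expectation_bounded.

(** * Characteristic functions and infinite divisibility *)

Lemma ER_pushforward (R : realType) d d' (T : measurableType d)
    (T' : measurableType d') (P : probability T R) (Q : probability T' R)
    (f : T -> T') (g : T' -> R) :
  measurable_fun [set: T] f ->
  (forall A, measurable A -> Q A = pushforward P f A) ->
  bounded_measurable g ->
  \int[Q]_y g y = \int[P]_x g (f x).
Proof.
move=> mf QPf bg.
pose F : {mfun T >-> T'} :=
  MeasurableFun.Pack (MeasurableFun.Class (isMeasurableFun.Build _ _ _ _ f mf)).
have bgf : bounded_measurable (g \o f).
  by case: bg => mg [M gM]; split; [exact: measurableT_comp|exists M => x /=].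
rewrite /Rintegral; congr fine.
rewrite (eq_measure_integral (distribution P F)); last first.
  by move=> A mA _; exact: QPf.
rewrite (integral_distribution (X := F) (f := EFin \o g))//.
- by apply/measurable_EFinP; case: bg.
- exact: bm_integrable.
Qed.

Section characteristic_functions.
Context (R : realType) (n : nat).
Implicit Types (mu nu rho : probability 'rV[R]_n R) (theta x y : 'rV[R]_n).

Lemma dotvDr theta x y : dotv theta (x + y) = dotv theta x + dotv theta y.
Proof.
by rewrite /dotv -big_split; apply: eq_bigr => i _; rewrite mxE mulrDr.
Qed.

Lemma dotvC theta x : dotv theta x = dotv x theta.
Proof. by apply: eq_bigr => i _; rewrite mulrC. Qed.

Lemma dotvDl theta x y : dotv (x + y) theta = dotv x theta + dotv y theta.
Proof. by rewrite !(dotvC _ theta) dotvDr. Qed.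

Lemma dotvZl (a : R) x theta : dotv (a *: x) theta = a * dotv x theta.
Proof. by rewrite mulr_sumr; apply: eq_bigr => i _; rewrite mxE mulrA. Qed.

Lemma dotvNl x theta : dotv (- x) theta = - dotv x theta.
Proof. by rewrite -scaleN1r dotvZl mulN1r. Qed.

Lemma dotv0l theta : dotv 0 theta = 0.
Proof. by rewrite -(scale0r 0) dotvZl mul0r. Qed.

Lemma dotv0r theta : dotv theta 0 = 0.
Proof. by rewrite dotvC dotv0l. Qed.

Lemma dotv_delta i x : dotv (delta_mx ord0 i) x = x ord0 i.
Proof.
rewrite /dotv (bigD1 i)//= big1 => [|k ki]; rewrite mxE !eqxx/=.
  by rewrite mul1r addr0.
by rewrite (negbTE ki) mul0r.
Qed.

Lemma cexp_i (u : R) : cexp ('i * u%:C) = cos u +i* sin u.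
Proof.
rewrite /cexp; simpc => /=.
by rewrite expR0; simpc.
Qed.

Lemma bm_cos_dotv theta : bounded_measurable (fun x => cos (dotv theta x)).
Proof. by apply: bm_cos; exact: measurable_dotv. Qed.

Lemma bm_sin_dotv theta : bounded_measurable (fun x => sin (dotv theta x)).
Proof. by apply: bm_sin; exact: measurable_dotv. Qed.

Lemma charfunE mu theta : charfun mu theta =
  (\int[mu]_x cos (dotv theta x)) +i* (\int[mu]_x sin (dotv theta x)).
Proof.
by rewrite /charfun /cintegral; congr (_ +i* _); apply: eq_Rintegral => x _;
  rewrite cexp_i.
Qed.

Lemma measurable_addv :
  measurable_fun [set: 'rV[R]_n * 'rV[R]_n] (fun p => p.1 + p.2).
Proof.
apply: measurable_fun_rV => i.
under eq_fun do rewrite mxE.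
apply: measurable_funD.
  exact: (measurableT_comp (measurable_coord i) measurable_fst).
exact: (measurableT_comp (measurable_coord i) measurable_snd).
Qed.

(** [convolution] is a bare set function. The law of the sum under the product measure is a genuine
    probability that agrees with it on measurable sets, and Fubini factors its characteristic
    function. *)
Lemma convolution_charfun rho nu : exists sigma : probability 'rV[R]_n R,
  (forall B, measurable B -> convolution rho nu B = sigma B) /\
  (forall theta, charfun sigma theta = charfun rho theta * charfun nu theta).
Proof.
pose F : {mfun ('rV[R]_n * 'rV[R]_n)%type >-> 'rV[R]_n} :=
  MeasurableFun.Pack (MeasurableFun.Class
    (isMeasurableFun.Build _ _ _ _ _ measurable_addv)).
exists (distribution (rho \x nu)%E F); split.
  move=> B mB; rewrite /convolution /distribution /pushforward /=.
  rewrite /product_measure1; apply: eq_integral => x _ /=.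
  by congr (nu _); apply/seteqP; split => y; rewrite /xsection/= inE.
move=> theta.
have iter_int (h : 'rV[R]_n * 'rV[R]_n -> R) : bounded_measurable h ->
    \int[(rho \x nu)%E]_p h p = \int[rho]_x \int[nu]_y h (x, y).
  move=> bh; rewrite /Rintegral -integral12_prod_meas1; last first.
    exact: (bm_integrable _ bh).
  congr fine; apply: eq_integral => x _ /=.
  rewrite /fubini_F /= fineK//.
  apply: (integrable_fin_num (D := setT)) => //.
  apply: (bm_integrable nu (f := fun y => h (x, y))).
  case: bh => mh [M hM]; split; last by exists M.
  exact: measurable_fun_pair2.
have push (g : 'rV[R]_n -> R) : bounded_measurable g ->
    \int[distribution (rho \x nu)%E F]_z g z =
    \int[rho]_x \int[nu]_y g (x + y).
  move=> bg.
  rewrite (@ER_pushforward _ _ _ _ _ (rho \x nu)%E _ F)//.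
  rewrite (iter_int (fun p => g (p.1 + p.2)))//.
  case: bg => mg [M gM]; split; last by exists M => p.
  by apply: measurableT_comp => //; exact: measurable_addv.
have bc := bm_cos_dotv theta; have bs := bm_sin_dotv theta.
have bZ (c : R) (g : 'rV[R]_n -> R) : bounded_measurable g ->
    bounded_measurable (fun y : 'rV[R]_n => c * g y).
  by move=> bg; apply: bmM => //; exact: bmC.
rewrite !charfunE !push//; simpc; congr (_ +i* _).
- under eq_Rintegral => x _.
    under eq_Rintegral => y _ do rewrite dotvDr cosD.
    rewrite (ERB _ (bZ _ _ bc) (bZ _ _ bs)) (ERZ _ _ bc) (ERZ _ _ bs).
    rewrite mulrC [X in _ - X]mulrC.
    over.
  rewrite (ERB _ (bZ _ _ bc) (bZ _ _ bs)) (ERZ _ _ bc) (ERZ _ _ bs).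
  by rewrite mulrC; congr (_ - _); rewrite mulrC.
- under eq_Rintegral => x _.
    under eq_Rintegral => y _ do rewrite dotvDr sinD.
    rewrite (ERD _ (bZ _ _ bc) (bZ _ _ bs)) (ERZ _ _ bc) (ERZ _ _ bs).
    rewrite mulrC [X in _ + X]mulrC.
    over.
  rewrite (ERD _ (bZ _ _ bs) (bZ _ _ bc)) (ERZ _ _ bc) (ERZ _ _ bs).
  by rewrite addrC mulrC; congr (_ + _); rewrite mulrC.
Qed.

Lemma infinitely_divisible_charfun (mu : set 'rV[R]_n -> \bar R) :
  infinitely_divisible mu ->
  forall k, exists rho nu : probability 'rV[R]_n R,
    (forall B, measurable B -> mu B = nu B) /\
    (forall theta, charfun nu theta = charfun rho theta ^+ k.+1).
Proof.
move=> ID k; have [rho mu_rho] := ID k; exists rho.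
suff [nu [nuE nuC]] : exists nu : probability 'rV[R]_n R,
    (forall B, measurable B -> iter k (convolution rho) rho B = nu B) /\
    (forall theta, charfun nu theta = charfun rho theta ^+ k.+1).
  by exists nu; split => // B mB; rewrite mu_rho// nuE.
elim: k {ID mu_rho} => [|k [nu [nuE nuC]]].
  by exists rho; split => // theta; rewrite expr1.
have [sigma [sE sC]] := convolution_charfun rho nu.
exists sigma; split => [B mB|theta]; last by rewrite sC nuC -exprS.
rewrite -sE//= /convolution; apply: eq_integral => x _.
apply: nuE.
have := measurable_fun_pair2 (f := fun p : 'rV[R]_n * 'rV[R]_n => p.1 + p.2)
  x measurable_addv.
by move=> /(_ measurableT _ mB); rewrite setTI.
Qed.

End characteristic_functions.

Lemma cvg_Rintegral_dominated (R : realType) d (T : measurableType d)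
    (mu : {measure set T -> \bar R}) (f_ : nat -> T -> R) (f g : T -> R) :
  (forall k, measurable_fun [set: T] (f_ k)) ->
  (forall x, f_ k x @[k --> \oo] --> f x) ->
  mu.-integrable [set: T] (EFin \o g) ->
  (forall k x, `|f_ k x| <= g x) ->
  \int[mu]_x f_ k x @[k --> \oo] --> \int[mu]_x f x.
Proof.
move=> mf_ f_f ig fg.
have mf : measurable_fun [set: T] f.
  by apply: (measurable_fun_cvg mf_) => x _; exact: f_f.
have [if_ _ cvgf] : [/\ mu.-integrable [set: T] (EFin \o f),
    [sequence (\int[mu]_x `|(f_ k x)%:E - (f x)%:E|)%E]_k @ \oo --> 0%E &
    [sequence (\int[mu]_x (f_ k x)%:E)%E]_k @ \oo --> (\int[mu]_x (f x)%:E)%E].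
  apply: (@dominated_convergence _ _ _ _ _ _ _ _ (EFin \o g)) => //.
  - by move=> k; exact/measurable_EFinP.
  - exact/measurable_EFinP.
  - by apply: aeW => x _; apply: cvg_EFin; [exact: nearW|exact: f_f].
  - by apply: aeW => x k _; rewrite lee_fin.
apply: fine_cvg; rewrite fineK//.
exact: (integrable_fin_num (D := setT)).
Qed.

Section squared_modulus.
Context (R : realType).
Implicit Types z w : R[i].

(** For a characteristic function this is the characteristic function of the symmetrized law, that
    of the difference of two independent copies. Being real, it has a logarithm without any choice
    of branch. *)
Definition sqmod z : R := complex.Re z ^+ 2 + complex.Im z ^+ 2.

Lemma sqmodM z w : sqmod (z * w) = sqmod z * sqmod w.
Proof. by case: z w => [a b] [c e]; rewrite /sqmod; simpc => /=; ring. Qed.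

Lemma sqmodX z k : sqmod (z ^+ k) = sqmod z ^+ k.
Proof.
elim: k => [|k IH]; first by rewrite !expr0 /sqmod/= expr0n addr0 expr1n.
by rewrite !exprS sqmodM IH.
Qed.

Lemma sqmod_ge0 z : 0 <= sqmod z.
Proof. by rewrite addr_ge0// sqr_ge0. Qed.

End squared_modulus.

(* [k (1 - e^{-u/k}) --> u], which turns k-th roots into logarithms. *)
Lemma cvg_rootB (R : realType) (u : R) :
  k.+1%:R * (1 - expR (- u / k.+1%:R)) @[k --> \oo] --> u.
Proof.
have cvg0 : - u / k.+1%:R @[k --> \oo] --> (0 : R).
  rewrite -(mulr0 (- u)); apply: cvgM; first exact: cvg_cst.
  exact: cvg_harmonic.
apply: (squeeze_cvgr (f := fun k => u * expR (- u / k.+1%:R))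
  (h := fun=> u)).
- near=> k; set y := _ / _.
  have ky : k.+1%:R * y = - u by rewrite mulrC divfK.
  have := expR_ge1Dx (- y); have := expR_ge1Dx y; rewrite expRN => h1 h2.
  have k0 : 0 < k.+1%:R :> R by [].
  have e0 := expR_gt0 y.
  have h3 : 1 >= expR y - y * expR y.
    have := ler_wpM2r (ltW e0) h2.
    by rewrite mulVf ?gt_eqF// mulrBl mul1r.
  have -> : u = - (k.+1%:R * y) by rewrite ky opprK.
  move: (expR y) h1 h3 => e h1 h3.
  rewrite -subr_ge0 -[X in _ && X]subr_ge0; apply/andP; split.
    rewrite [X in 0 <= X](_ : _ = k.+1%:R * (1 - (e - y * e))); last by ring.
    by rewrite mulr_ge0// subr_ge0.
  rewrite [X in 0 <= X](_ : _ = k.+1%:R * (e - (1 + y))); last by ring.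
  by rewrite mulr_ge0// subr_ge0.
- have /(cvgM (cvg_cst u)) : expR (- u / k.+1%:R) @[k --> \oo] --> expR 0.
    by apply: continuous_cvg cvg0; exact: continuous_expR.
  by rewrite expR0 mulr1.
- exact: cvg_cst.
Unshelve. all: by end_near. Qed.

(** * Positivity for trigonometric polynomials, and its logarithmic form *)

Section trigonometric_polynomials.
Context (R : realType) (n : nat).
Implicit Types (rho : probability 'rV[R]_n R) (theta x : 'rV[R]_n).

(* A finite list of pairs (c, theta) stands for [\sum c cos <theta, x>]. *)
Definition trigpoly (s : seq (R * 'rV[R]_n)) x :=
  \sum_(p <- s) p.1 * cos (dotv p.2 x).

(** For independent x and y of law [rho], [sqmod (charfun rho theta)] is the mean of cos <theta, x -
    y>; hence the sum is the mean of the polynomial at x - y, computed here as an iterated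
    integral. *)
Lemma trigpoly_charfun rho (s : seq (R * 'rV[R]_n)) :
  (forall x, 0 <= trigpoly s x) ->
  0 <= \sum_(p <- s) p.1 * sqmod (charfun rho p.2).
Proof.
move=> s0.
have bc c theta : bounded_measurable (fun x => c * cos (dotv theta x)).
  by apply: bmM; [exact: bmC|exact: bm_cos_dotv].
have bs c theta : bounded_measurable (fun x => c * sin (dotv theta x)).
  by apply: bmM; [exact: bmC|exact: bm_sin_dotv].
pose C theta := \int[rho]_x cos (dotv theta x).
pose S theta := \int[rho]_x sin (dotv theta x).
have h y : 0 <= \sum_(p <- s)
    ((p.1 * C p.2) * cos (dotv p.2 y) + (p.1 * S p.2) * sin (dotv p.2 y)).
  have : 0 <= \int[rho]_x trigpoly s (x - y).
    by apply: Rintegral_ge0 => x _.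
  congr (_ <= _).
  under eq_Rintegral => x _.
    rewrite /trigpoly; under eq_bigr => p _.
      rewrite dotvDr [dotv _ (- y)]dotvC dotvNl cosB mulrDr mulrCA mulrC.
      rewrite [X in _ + X]mulrCA [X in _ + X]mulrC (dotvC y).
      rewrite -mulrA (mulrC (cos (dotv _ y))) mulrA.
      rewrite -[X in _ + X]mulrA (mulrC (sin (dotv _ y))) [X in _ + X]mulrA.
      over.
    over.
  rewrite ER_sum; last first.
    move=> p; apply: bmD; apply: bmM => //; exact: bmC.
  apply: eq_bigr => p _.
  rewrite ERD; [|by apply: bmM => //; exact: bmC..].
  congr (_ + _).
  - under eq_Rintegral do rewrite mulrC.
    by rewrite ERZ// ERZ ?(mulrC (cos _))//; exact: bm_cos_dotv.
  - under eq_Rintegral do rewrite mulrC.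
    by rewrite ERZ// ERZ ?(mulrC (sin _))//; exact: bm_sin_dotv.
have : 0 <= \int[rho]_y \sum_(p <- s)
    ((p.1 * C p.2) * cos (dotv p.2 y) + (p.1 * S p.2) * sin (dotv p.2 y)).
  by apply: Rintegral_ge0 => y _; exact: h.
congr (_ <= _); rewrite ER_sum; last by move=> p; exact: bmD.
apply: eq_bigr => p _.
rewrite ERD// ERZ; last exact: bm_cos_dotv.
rewrite ERZ; last exact: bm_sin_dotv.
by rewrite charfunE /sqmod/= -/(C _) -/(S _); ring.
Qed.

End trigonometric_polynomials.

Section charfun_modulus.
Context (R : realType) (n : nat).
Implicit Types (rho : probability 'rV[R]_n R) (theta : 'rV[R]_n).

Lemma sqmod_charfun0 rho : sqmod (charfun rho 0) = 1.
Proof.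
rewrite charfunE /sqmod/=.
under eq_Rintegral do rewrite dotv0l cos0.
under [X in _ + X ^+ _]eq_Rintegral do rewrite dotv0l sin0.
by rewrite !ERC expr1n expr0n addr0.
Qed.

Lemma sqmod_charfun_le1 rho theta : sqmod (charfun rho theta) <= 1.
Proof.
have := @trigpoly_charfun _ _ rho [:: (1, 0); (-1, theta)].
rewrite !big_cons big_nil/= sqmod_charfun0 addr0 mul1r mulN1r subr_ge0; apply.
move=> x; rewrite /trigpoly !big_cons big_nil/= dotv0l cos0.
by rewrite addr0 mul1r mulN1r subr_ge0 cos_le1.
Qed.

(** Comes from 3 - 4 cos u + cos 2u = 2 (1 - cos u)^2. Iterated, it carries closeness of the modulus
    to 1 from a small multiple of [theta] over to [theta] itself. *)
Lemma sqmod_charfun_double rho theta :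
  1 - sqmod (charfun rho (2 *: theta)) <= 4 * (1 - sqmod (charfun rho theta)).
Proof.
have := @trigpoly_charfun _ _ rho [:: (3, 0); (-4, theta); (1, 2 *: theta)].
rewrite !big_cons big_nil/= sqmod_charfun0 => h.
suff : 0 <= 3 * 1 + (-4 * sqmod (charfun rho theta) +
    (1 * sqmod (charfun rho (2 *: theta)) + 0)) by lra.
apply: h => x; rewrite /trigpoly !big_cons big_nil/= dotv0l cos0 dotvZl.
have -> (u : R) : 3 * 1 + (-4 * cos u + (1 * cos (2 * u) + 0)) =
    2 * (1 - cos u) ^+ 2.
  by rewrite (mulr_natl u) cos_mulr2n; ring.
by rewrite mulr_ge0// sqr_ge0.
Qed.

Lemma sqmod_charfun_pow2 rho theta j :
  1 - sqmod (charfun rho theta) <=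
  4 ^+ j * (1 - sqmod (charfun rho ((2 ^+ j)^-1 *: theta))).
Proof.
elim: j => [|j IH]; first by rewrite !expr0 invr1 scale1r mul1r.
apply: (le_trans IH); rewrite exprSr -mulrA; apply: ler_wpM2l.
  by rewrite exprn_ge0.
have -> : (2 ^+ j)^-1 *: theta = 2 *: ((2 ^+ j.+1)^-1 *: theta).
  rewrite scalerA exprS invfM mulrA divff ?mul1r//.
exact: sqmod_charfun_double.
Qed.

Lemma cvg_sqmod_charfun0 rho theta (r : nat -> R) :
  r @ \oo --> (0 : R) -> sqmod (charfun rho (r k *: theta)) @[k --> \oo] --> (1 : R).
Proof.
move=> r0.
have -> : 1 = (\int[rho]_x cos 0) ^+ 2 + (\int[rho]_x sin 0) ^+ 2 :> R.
  by rewrite !ERC cos0 sin0 expr1n expr0n addr0.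
under eq_cvg do rewrite charfunE /sqmod/=.
have cvg0 x : dotv (r k *: theta) x @[k --> \oo] --> (0 : R).
  have : r k * dotv theta x @[k --> \oo] --> 0 * dotv theta x.
    by apply: cvgM; [exact: r0|exact: cvg_cst].
  by rewrite mul0r; under eq_fun do rewrite -dotvZl.
have cC : \int[rho]_x cos (dotv (r k *: theta) x) @[k --> \oo] -->
    \int[rho]_x cos 0.
  apply: (cvg_Rintegral_dominated (g := cst 1)) => [k|x||k x].
  - by have [] := bm_cos_dotv (r k *: theta).
  - by apply: (cvg_comp _ _ (cvg0 x)); exact: continuous_cos.
  - exact: (bm_integrable _ (bmC _ _)).
  - exact: cos_max.
have cS : \int[rho]_x sin (dotv (r k *: theta) x) @[k --> \oo] -->
    \int[rho]_x sin 0.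
  apply: (cvg_Rintegral_dominated (g := cst 1)) => [k|x||k x].
  - by have [] := bm_sin_dotv (r k *: theta).
  - by apply: (cvg_comp _ _ (cvg0 x)); exact: continuous_sin.
  - exact: (bm_integrable _ (bmC _ _)).
  - exact: sin_max.
by apply: cvgD; rewrite expr2; apply: cvgM.
Qed.

End charfun_modulus.

Section infinitely_divisible_exponent.
Context (R : realType) (n : nat).
Implicit Types (phi : 'rV[R]_n -> R[i]) (theta : 'rV[R]_n).

(** A property of the function alone, so that it applies to means over a probability space without
    naming a law. The case k = 0 says that [phi] is a characteristic function. *)
Definition id_charfun phi := forall k, exists rho : probability 'rV[R]_n R,
  forall theta, phi theta = charfun rho theta ^+ k.+1.

Lemma id_charfunW phi : id_charfun phi ->
  exists rho : probability 'rV[R]_n R, phi = charfun rho.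
Proof.
by move=> /(_ 0)[rho rhoE]; exists rho; apply/funext => theta; rewrite rhoE.
Qed.

Lemma root_expR (a A : R) k : 0 <= a -> A = a ^+ k.+1 -> 0 < A ->
  a = expR (- - ln A / k.+1%:R).
Proof.
move=> a0 -> A0.
have {}a0 : 0 < a.
  by rewrite lt_neqAle a0 andbT eq_sym; apply: contraTneq A0 => ->; rewrite expr0n ltxx.
by rewrite lnXn// opprK -(mulr_natr (ln a)) mulfK// lnK.
Qed.

(** At a zero of [phi] all the roots vanish too, so iterated doubling gives 1 <= 4^j (1 -
    |rho_k(theta / 2^j)|^2). Fix j with [phi] nonzero at theta / 2^j, which exists by continuity at
    0. As k grows the right side tends to 0, because roots of a fixed positive number tend to 1. *)
Lemma id_charfun_gt0 phi theta : id_charfun phi -> 0 < sqmod (phi theta).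
Proof.
move=> ID; rewrite lt_neqAle sqmod_ge0 andbT eq_sym; apply/negP => /eqP phi0.
have [j] : exists j : nat, 0 < sqmod (phi ((2 ^+ j)^-1 *: theta)).
  have [rho ->] := id_charfunW ID.
  have : (2 ^+ k)^-1 @[k --> \oo] --> (0 : R).
    under eq_cvg do rewrite -exprVn.
    by apply: cvg_expr; rewrite ger0_norm ?invf_lt1// ltr1n.
  move=> /(cvg_sqmod_charfun0 rho theta)/cvgr_gt/(_ 0 ltr01)[j _ jP].
  by exists j; exact: (jP j (leqnn j)).
set theta' := _ *: theta => phi'0.
set u := - ln (sqmod (phi theta')).
suff : (1 : R) <= 4 ^+ j * 0 by rewrite mulr0 ler10.
have cvg0 : 4 ^+ j * (1 - expR (- u / k.+1%:R)) @[k --> \oo] --> 4 ^+ j * (0 : R).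
  apply: cvgM; first exact: cvg_cst.
  rewrite -(subrr (1 : R)); apply: cvgB; first exact: cvg_cst.
  rewrite -{2}expR0; apply: continuous_cvg; first exact: continuous_expR.
  rewrite -(mulr0 (- u)); apply: cvgM; first exact: cvg_cst.
  exact: cvg_harmonic.
apply: (ler_cvg_to (cvg_cst (1 : R)) cvg0); apply: nearW => k /=.
have [rho rhoE] := ID k.
have <- : sqmod (charfun rho theta') = expR (- u / k.+1%:R).
  by apply: root_expR => //; rewrite ?sqmod_ge0 ?rhoE ?sqmodX.
apply: le_trans (sqmod_charfun_pow2 rho theta j).
suff -> : sqmod (charfun rho theta) = 0 by rewrite subr0.
by move: phi0; rewrite rhoE sqmodX => /eqP; rewrite expf_eq0 => /andP[_ /eqP].
Qed.

Definition symexp phi theta : R := - ln (sqmod (phi theta)).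

Lemma id_charfun_root phi k : id_charfun phi ->
  exists2 rho : probability 'rV[R]_n R,
    forall theta, phi theta = charfun rho theta ^+ k.+1 &
    forall theta, sqmod (charfun rho theta) =
      expR (- symexp phi theta / k.+1%:R).
Proof.
move=> ID; have [rho rhoE] := ID k; exists rho => // theta.
apply: root_expR; rewrite ?sqmod_ge0 ?rhoE ?sqmodX//.
by rewrite -sqmodX -rhoE; exact: id_charfun_gt0.
Qed.

(** The sign is reversed because psi is the limit of (k + 1) (1 - |rho_k|^2). The inequalities
    between exponents below are obtained by listing the coefficients of a suitable nonnegative
    polynomial. *)
Lemma symexp_trigpoly phi (s : seq (R * 'rV[R]_n)) : id_charfun phi ->
  (forall x, 0 <= trigpoly s x) -> \sum_(p <- s) p.1 = 0 ->
  \sum_(p <- s) p.1 * symexp phi p.2 <= 0.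
Proof.
move=> ID s0 s1.
pose r (k : nat) := \sum_(p <- s)
  p.1 * (k.+1%:R * (1 - expR (- symexp phi p.2 / k.+1%:R))).
have rcvg : r @ \oo --> \sum_(p <- s) p.1 * symexp phi p.2.
  rewrite /r; elim: (s) => [|p s' IH].
    by under eq_cvg do rewrite big_nil; rewrite big_nil; exact: cvg_cst.
  under eq_cvg do rewrite big_cons; rewrite big_cons.
  by apply: cvgD => //; apply: cvgM; [exact: cvg_cst|exact: cvg_rootB].
apply: (ler_cvg_to rcvg (cvg_cst (0 : R))); apply: nearW => k.
have [rho _ rhoE] := id_charfun_root k ID.
have := trigpoly_charfun rho s0; rewrite /r.
have -> : \sum_(p <- s) p.1 * (k.+1%:R *
    (1 - expR (- symexp phi p.2 / k.+1%:R))) =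
    - k.+1%:R * \sum_(p <- s) p.1 * sqmod (charfun rho p.2).
  (* The coefficients sum to 0, so the constant 1 in each 1 - |rho_k|^2 drops out. *)
  transitivity (k.+1%:R * (\sum_(p <- s) p.1 -
      \sum_(p <- s) p.1 * sqmod (charfun rho p.2))).
    rewrite -sumrB mulr_sumr; apply: eq_bigr => p _; rewrite rhoE; ring.
  by rewrite s1 sub0r mulrN mulNr.
by move=> h; rewrite mulNr oppr_le0 mulr_ge0.
Qed.

Lemma symexp0 phi : id_charfun phi -> symexp phi 0 = 0.
Proof.
by move=> /id_charfunW[rho ->]; rewrite /symexp sqmod_charfun0 ln1 oppr0.
Qed.

Lemma symexp_ge0 phi theta : id_charfun phi -> 0 <= symexp phi theta.
Proof.
move=> /id_charfunW[rho ->]; rewrite /symexp oppr_ge0 ln_le0//.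
exact: sqmod_charfun_le1.
Qed.

Lemma cvg_symexp0 phi theta (r : nat -> R) : id_charfun phi ->
  r @ \oo --> (0 : R) -> symexp phi (r k *: theta) @[k --> \oo] --> (0 : R).
Proof.
move=> /id_charfunW[rho ->] r0; rewrite -oppr0 -ln1; apply: cvgN.
apply: continuous_cvg (cvg_sqmod_charfun0 rho theta r0).
exact: continuous_ln.
Qed.

End infinitely_divisible_exponent.

(** * Positivity inequalities for the exponent *)

Section trigonometric_inequalities.
Context (R : realType).
Implicit Types a b c eta : R.

Lemma norm_le_sqr (x y : R) : 0 <= y -> x ^+ 2 <= y ^+ 2 -> `|x| <= y.
Proof.
by move=> y0 xy; rewrite -ler_sqr ?nnegrE// real_normK ?num_real.
Qed.

(** A sign is encoded as b with b^2 = 1, so that a single trigonometric polynomial with b among its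
    coefficients yields both halves of a bound on an absolute value. *)
Lemma norm_le_signs (x y : R) :
  (forall b, b ^+ 2 = 1 -> b * x <= y) -> `|x| <= y.
Proof.
move=> h; rewrite ler_norml; apply/andP; split.
  by have := h (-1); rewrite sqrrN expr1n => /(_ erefl); lra.
by have := h 1; rewrite expr1n => /(_ erefl); lra.
Qed.

Lemma mul_sign_le (b x : R) : b ^+ 2 = 1 -> b * x <= `|x|.
Proof.
move=> b2; have nb : `|b| = 1.
  by apply/eqP; rewrite -(@eqrXn2 _ 2)// ?real_normK ?num_real ?b2 ?expr1n.
by rewrite (le_trans (ler_norm _))// normrM nb mul1r.
Qed.

Lemma sqr_cosB1 a : (cos a - 1) ^+ 2 + sin a ^+ 2 = 2 * (1 - cos a).
Proof. by rewrite sin2cos2; ring. Qed.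

Lemma onem_cos_ge0 a : 0 <= 1 - cos a.
Proof. by rewrite subr_ge0 cos_le1. Qed.

(** The parallelogram law for z = e^{ia} - 1 and w = e^{-ib} - 1: here |z - w|^2 = 2 (1 - cos (a +
    b)), and the square that is discarded is |z + w|^2. *)
Lemma onem_cosD_le a b :
  1 - cos (a + b) <= 2 * (1 - cos a) + 2 * (1 - cos b).
Proof.
rewrite cosD; have := sqr_ge0 (sin a - sin b); have := sqr_ge0 (cos a + cos b - 2).
have := sin2cos2 a; have := sin2cos2 b.
move: (cos a) (cos b) (sin a) (sin b) => x y z t h1 h2 h3 h4.
have -> : 2 * (1 - x) + 2 * (1 - y) = 1 - (x * y - z * t) +
  ((x + y - 2) ^+ 2 + (z - t) ^+ 2 + (1 - x ^+ 2 - z ^+ 2) + (1 - y ^+ 2 - t ^+ 2)) / 2.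
  by field.
lra.
Qed.

(* [Re ((e^{ia} - 1) (e^{ib} - 1))], bounded by AM-GM. *)
Lemma cos_cross2_le a b eta : 0 < eta ->
  `|cos (a + b) - cos a - cos b + 1| <=
  eta^-1 * (1 - cos a) + eta * (1 - cos b).
Proof.
move=> eta0.
have p0 := onem_cos_ge0 a; have q0 := onem_cos_ge0 b.
apply: norm_le_sqr; first by rewrite addr_ge0// mulr_ge0// ?invr_ge0 ltW.
apply: (@le_trans _ _ ((2 * (1 - cos a)) * (2 * (1 - cos b)))).
  rewrite -!sqr_cosB1 cosD -subr_ge0.
  rewrite [X in 0 <= X](_ : _ = ((cos a - 1) * sin b + sin a * (cos b - 1)) ^+ 2).
    by rewrite sqr_ge0.
  by ring.
rewrite -subr_ge0 [X in 0 <= X](_ : _ =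
  (eta^-1 * (1 - cos a) - eta * (1 - cos b)) ^+ 2); first by rewrite sqr_ge0.
by field; rewrite gt_eqF.
Qed.

(* [Re ((e^{ia} - 1) (e^{ib} - 1) (e^{ic} - 1))], bounded by AM-GM. *)
Lemma cos_cross3_le a b c eta : 0 < eta ->
  `|cos (a + b + c) - cos (a + b) - cos (a + c) - cos (b + c)
    + cos a + cos b + cos c - 1| <=
  ((1 - cos a) + (1 - cos b)) * (eta + (2 * eta)^-1 * (1 - cos c)).
Proof.
move=> eta0.
have p0 := onem_cos_ge0 a; have q0 := onem_cos_ge0 b.
have r0 := onem_cos_ge0 c.
have e0 : 0 <= (2 * eta)^-1 by rewrite invr_ge0 mulr_ge0// ltW.
apply: norm_le_sqr.
  by apply: mulr_ge0; apply: addr_ge0 => //; [exact: ltW|exact: mulr_ge0].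
apply: (@le_trans _ _ ((2 * (1 - cos a)) * (2 * (1 - cos b)) * (2 * (1 - cos c)))).
  rewrite -!sqr_cosB1 cosD sinD !cosD -subr_ge0.
  set x := cos a; set y := cos b; set z := cos c.
  set x' := sin a; set y' := sin b; set z' := sin c.
  rewrite [X in 0 <= X](_ : _ =
    (((x - 1) * (y - 1) - x' * y') * z'
      + ((x - 1) * y' + x' * (y - 1)) * (z - 1)) ^+ 2); first by rewrite sqr_ge0.
  by ring.
move: (1 - cos a) (1 - cos b) (1 - cos c) p0 q0 r0 => p q r p0 q0 r0.
rewrite -subr_ge0 [X in 0 <= X](_ : _ =
  ((p - q) ^+ 2) * (eta + (2 * eta)^-1 * r) ^+ 2
   + 4 * (p * q) * (eta - (2 * eta)^-1 * r) ^+ 2).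
  by rewrite addr_ge0// mulr_ge0// ?sqr_ge0// mulr_ge0// mulr_ge0.
by field; rewrite gt_eqF.
Qed.

End trigonometric_inequalities.

Section exponent_inequalities.
Context (R : realType) (n : nat) (phi : 'rV[R]_n -> R[i]).
Hypothesis ID : id_charfun phi.
Implicit Types u v : 'rV[R]_n.
Local Notation psi := (symexp phi).

(* With Levy measure Q of the symmetrized law, [cross2 u v] is
   [\int Re ((e^{iu} - 1) (e^{iv} - 1)) dQ] plus a Gaussian covariance term, and
   [cross4 u v] is [\int (1 - cos u) (1 - cos v) dQ]. *)
Definition cross2 u v : R := psi u + psi v - psi (u + v).
Definition cross4 u v : R := psi u + psi v - 2^-1 * (psi (u + v) + psi (u - v)).

Lemma cross4_ge0 u v : 0 <= cross4 u v.
Proof.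
have := @symexp_trigpoly _ _ phi [:: (1, 0); (-1, u); (-1, v);
  (2^-1, u + v); (2^-1, u - v)] ID.
rewrite !big_cons !big_nil/= symexp0// /cross4 => h.
suff : 1 * 0 + (-1 * psi u + (-1 * psi v + (2^-1 * psi (u + v) +
   (2^-1 * psi (u - v) + 0)))) <= 0 by lra.
apply: h; last by field.
move=> x; rewrite /trigpoly !big_cons big_nil/= dotv0l cos0.
rewrite !dotvDl !dotvNl cosD cosB.
set a := cos _; set b := cos _.
rewrite [X in 0 <= X](_ : _ = (1 - a) * (1 - b)); last by field.
by rewrite mulr_ge0// onem_cos_ge0.
Qed.

(* After expanding the products of cosines, the trigonometric polynomial below
   is [(2 (1 - cos u) + 2 (1 - cos u') - (1 - cos (u + u'))) (1 - cos v)]. *)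
Lemma cross4Dl u u' v : cross4 (u + u') v <= 2 * cross4 u v + 2 * cross4 u' v.
Proof.
have := @symexp_trigpoly _ _ phi [:: (3, 0); (-2, u); (-2, u'); (1, u + u');
  (-3, v); (1, u + v); (1, u - v); (1, u' + v); (1, u' - v);
  (- 2^-1, u + u' + v); (- 2^-1, u + u' - v)] ID.
rewrite !big_cons !big_nil/= symexp0// /cross4 => h.
suff : 3 * 0 + (-2 * psi u + (-2 * psi u' + (1 * psi (u + u') + (-3 * psi v +
   (1 * psi (u + v) + (1 * psi (u - v) + (1 * psi (u' + v) + (1 * psi (u' - v) +
   (- 2^-1 * psi (u + u' + v) + (- 2^-1 * psi (u + u' - v) + 0)))))))))) <= 0.
  lra.
apply: h; last by field.
move=> x; rewrite /trigpoly !big_cons big_nil/= dotv0l cos0.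
rewrite ![dotv (_ + v) x]dotvDl ![dotv (_ - v) x]dotvDl dotvNl.
rewrite ![cos (_ + dotv v x)]cosD ![cos (_ - dotv v x)]cosB.
have h1 : 0 <= 2 * (1 - cos (dotv u x)) + 2 * (1 - cos (dotv u' x)) -
    (1 - cos (dotv (u + u') x)).
  by rewrite subr_ge0 dotvDl onem_cosD_le.
have := mulr_ge0 h1 (onem_cos_ge0 (dotv v x)).
by congr (_ <= _); field.
Qed.

(** In terms of the Levy measure, the defect of additivity is the integral of Re ((e^{iu} - 1)
    (e^{iu'} - 1) (e^{iv} - 1)), the Gaussian covariance cancelling by bilinearity. [cos_cross3_le]
    dominates the integrand. *)
Lemma cross2Dl eta u u' v : 0 < eta ->
  `|cross2 (u + u') v - cross2 u v - cross2 u' v| <=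
  eta * (psi u + psi u') + (2 * eta)^-1 * (cross4 u v + cross4 u' v).
Proof.
move=> eta0; set k := (2 * eta)^-1.
have e0 : eta != 0 by rewrite gt_eqF.
apply: norm_le_signs => b b2.
have := @symexp_trigpoly _ _ phi [:: (2 * (eta + k) + b, 0);
  (- (eta + k) - b, u); (- (eta + k) - b, u'); (- (2 * k) - b, v);
  (k / 2 + b, u + v); (k / 2, u - v); (k / 2 + b, u' + v); (k / 2, u' - v);
  (b, u + u'); (- b, u + u' + v)] ID.
rewrite !big_cons !big_nil/= symexp0// /cross2 /cross4 => h.
suff : (2 * (eta + k) + b) * 0 + ((- (eta + k) - b) * psi u +
   ((- (eta + k) - b) * psi u' + ((- (2 * k) - b) * psi v +
   ((k / 2 + b) * psi (u + v) + (k / 2 * psi (u - v) +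
   ((k / 2 + b) * psi (u' + v) + (k / 2 * psi (u' - v) +
   (b * psi (u + u') + (- b * psi (u + u' + v) + 0))))))))) <= 0.
  rewrite -subr_ge0 => h'; rewrite -subr_ge0; move: h'.
  by congr (_ <= _); field.
apply: h; last by field.
move=> x; rewrite /trigpoly !big_cons big_nil/= dotv0l cos0.
have := cos_cross3_le (dotv u x) (dotv u' x) (dotv v x) eta0; rewrite -/k.
rewrite !dotvDl !dotvNl !cosB.
set A := (X in `|X| <= _) => hA.
have := le_trans (mul_sign_le A b2) hA; rewrite -subr_ge0; congr (_ <= _).
by rewrite /A [cos (dotv u x + dotv v x)]cosD [cos (dotv u' x + dotv v x)]cosD; field.
Qed.

(** This is the equicontinuity at 0: for a suitable eta the bound is small together with [psi u],
    uniformly over all [phi] with the same [psi v]. *)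
Lemma cross2_le eta u v : 0 < eta ->
  `|cross2 u v| <= eta^-1 * psi u + eta * psi v.
Proof.
move=> eta0.
have e0 : eta != 0 by rewrite gt_eqF.
apply: norm_le_signs => b b2.
have := @symexp_trigpoly _ _ phi [:: (eta^-1 + eta - b, 0);
  (- eta^-1 + b, u); (- eta + b, v); (- b, u + v)] ID.
rewrite !big_cons !big_nil/= symexp0// /cross2 => h.
suff : (eta^-1 + eta - b) * 0 + ((- eta^-1 + b) * psi u +
    ((- eta + b) * psi v + (- b * psi (u + v) + 0))) <= 0.
  rewrite -subr_ge0 => h'; rewrite -subr_ge0; move: h'.
  by congr (_ <= _); field.
apply: h; last by field.
move=> x; rewrite /trigpoly !big_cons big_nil/= dotv0l cos0 dotvDl.
have := cos_cross2_le (dotv u x) (dotv v x) eta0.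
set A := (X in `|X| <= _) => hA.
have := le_trans (mul_sign_le A b2) hA; rewrite -subr_ge0; congr (_ <= _).
by rewrite /A; field.
Qed.

End exponent_inequalities.

(** * The phase of the characteristic function *)

Section complex_modulus.
Context (R : realType).
Implicit Types z w : R[i].

Lemma normc_sqrt z : Normc.normc z = Num.sqrt (sqmod z).
Proof. by case: z. Qed.

Lemma normc_ge0 z : 0 <= Normc.normc z.
Proof. by rewrite normc_sqrt sqrtr_ge0. Qed.

Lemma normc_real (a : R) : 0 <= a -> Normc.normc a%:C = a.
Proof. by move=> a0; rewrite /= expr0n addr0 sqrtr_sqr ger0_norm. Qed.

Lemma normcX z k : Normc.normc (z ^+ k) = Normc.normc z ^+ k.
Proof.
elim: k => [|k IH]; first by rewrite !expr0 Normc.normc1.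
by rewrite !exprS Normc.normcM IH.
Qed.

Lemma normc_subXX z w k : Normc.normc z <= 1 -> Normc.normc w <= 1 ->
  Normc.normc (z ^+ k - w ^+ k) <= k%:R * Normc.normc (z - w).
Proof.
move=> z1 w1; elim: k => [|k IH].
  by rewrite !expr0 subrr Normc.normc0 mul0r.
have -> : z ^+ k.+1 - w ^+ k.+1 = z * (z ^+ k - w ^+ k) + (z - w) * w ^+ k.
  by rewrite !exprS; ring.
apply: (le_trans (le_normcD _ _)); rewrite !Normc.normcM normcX.
rewrite -addn1 natrD mulrDl mul1r lerD//.
  by rewrite (le_trans _ IH)// ler_piMl// normc_ge0.
by rewrite ler_piMr ?normc_ge0// exprn_ile1// normc_ge0.
Qed.

Lemma normr_Re_le z : `|complex.Re z| <= Normc.normc z.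
Proof.
rewrite normc_sqrt -sqrtr_sqr ler_sqrt; last exact: sqmod_ge0.
by rewrite /sqmod lerDl sqr_ge0.
Qed.

Lemma ler_Re_normc z : complex.Re z <= Normc.normc z.
Proof. exact: le_trans (ler_norm _) (normr_Re_le z). Qed.

(** Lets an imaginary part, which is linear in the law, stand in for an argument. The factor 2
    collects |G| itself and the gap between D and the modulus, at most |G|. *)
Lemma normc_subRe_le (D G : R) : 0 <= D ->
  Normc.normc ((D +i* G) - (Normc.normc (D +i* G))%:C) <= 2 * `|G|.
Proof.
move=> D0; set m := Normc.normc (D +i* G).
have -> : (D +i* G) - m%:C = (D - m)%:C + 0 +i* G by simpc.
have Dm : D <= m by exact: (ler_Re_normc (D +i* G)).
have nG : Normc.normc (0 +i* G) = `|G|.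
  by rewrite /= expr0n add0r sqrtr_sqr.
apply: (le_trans (le_normcD _ _)); rewrite nG mulr_natl mulr2n lerD2r.
rewrite /= expr0n addr0 sqrtr_sqr ler0_norm ?subr_le0// opprB lerBlDl.
have := le_normcD D%:C (0 +i* G); rewrite nG normc_real//.
by congr (_ <= _); rewrite /m; simpc.
Qed.

Lemma polar z : exists alpha,
  z = (Normc.normc z)%:C * (cos alpha +i* sin alpha).
Proof.
have [z0|z0] := eqVneq (Normc.normc z) 0.
  by exists 0; rewrite (Normc.eq0_normc z0) Normc.normc0; simpc.
have zp : 0 < Normc.normc z by rewrite lt_neqAle eq_sym z0 normc_ge0.
case: z z0 zp => [a b]; set m := Normc.normc _ => m0 mp.
have m2 : a ^+ 2 + b ^+ 2 = m ^+ 2.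
  by rewrite /m /= sqr_sqrtr// addr_ge0// sqr_ge0.
pose x := a / m; pose y := b / m.
have xy : x ^+ 2 + y ^+ 2 = 1.
  by rewrite !expr_div_n -mulrDl m2 divff// expf_neq0.
have x1 : -1 <= x <= 1.
  rewrite -ler_norml; apply: norm_le_sqr => //.
  by rewrite expr1n -xy lerDl sqr_ge0.
have sx : sin (acos x) = `|y|.
  by rewrite sin_acos// -xy addrAC subrr add0r sqrtr_sqr.
have cx : cos (acos x) = x by rewrite acosK// in_itv.
have ax : a = m * x by rewrite mulrC divfK.
have ay : b = m * y by rewrite mulrC divfK.
have [y0|y0] := leP 0 y.
  by exists (acos x); rewrite cx sx ger0_norm//; simpc; congr (_ +i* _).
exists (- acos x); rewrite cosN sinN cx sx ltr0_norm// opprK.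
by simpc; congr (_ +i* _).
Qed.

End complex_modulus.

Section phase.
Context (R : realType) (n : nat).
Implicit Types (rho : probability 'rV[R]_n R) (u v : 'rV[R]_n).

Lemma shifted_charfun rho u gamma :
  (\int[rho]_x cos (dotv u x - gamma)) +i* (\int[rho]_x sin (dotv u x - gamma))
  = charfun rho u * (cos gamma -i* sin gamma).
Proof.
have bc c : bounded_measurable (fun x : 'rV[R]_n => c * cos (dotv u x)).
  by apply: bmM; [exact: bmC|exact: bm_cos_dotv].
have bs c : bounded_measurable (fun x : 'rV[R]_n => c * sin (dotv u x)).
  by apply: bmM; [exact: bmC|exact: bm_sin_dotv].
have bC := bm_cos_dotv u; have bS := bm_sin_dotv u.
have -> : \int[rho]_x cos (dotv u x - gamma) =
    cos gamma * \int[rho]_x cos (dotv u x) + sin gamma * \int[rho]_x sin (dotv u x).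
  rewrite -!ERZ// -ERD//; apply: eq_Rintegral => x _.
  by rewrite cosB mulrC [X in _ + X]mulrC.
have -> : \int[rho]_x sin (dotv u x - gamma) =
    cos gamma * \int[rho]_x sin (dotv u x) - sin gamma * \int[rho]_x cos (dotv u x).
  rewrite -!ERZ// -ERB//; apply: eq_Rintegral => x _.
  by rewrite sinB mulrC [X in _ - X]mulrC.
by rewrite charfunE; simpc; congr (_ +i* _); ring.
Qed.

(** The left side is |Im ((e^{ia} - 1) (e^{ib} - 1))|, that is |sin a (1 - cos b) + sin b (1 - cos
    a)|. Each sine is bounded by AM-GM from sin^2 c <= 2 (1 - cos c), leaving a small multiple of
    the first-order terms and the product that [cross4] measures. *)
Lemma sin_cross_le (a b eta : R) : 0 < eta ->
  `|sin (a + b) - sin a - sin b| <=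
  eta / 2 * ((1 - cos a) + (1 - cos b)) +
  2 / eta * ((1 - cos a) * (1 - cos b)).
Proof.
move=> eta0.
have sle (c : R) : `|sin c| <= eta / 2 + eta^-1 * (1 - cos c).
  apply: norm_le_sqr.
    by rewrite addr_ge0// ?mulr_ge0 ?invr_ge0 ?onem_cos_ge0// ltW.
  apply: (@le_trans _ _ (2 * (1 - cos c))).
    by rewrite -sqr_cosB1 lerDr sqr_ge0.
  rewrite -subr_ge0 [X in 0 <= X](_ : _ =
    (eta / 2 - eta^-1 * (1 - cos c)) ^+ 2); first by rewrite sqr_ge0.
  by field; rewrite gt_eqF.
have -> : sin (a + b) - sin a - sin b =
    - (sin a * (1 - cos b)) - sin b * (1 - cos a) by rewrite sinD; ring.
apply: (le_trans (ler_normB _ _)); rewrite normrN !normrM.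
rewrite ![`|1 - _|]ger0_norm ?onem_cos_ge0//.
have h1 := ler_wpM2r (onem_cos_ge0 b) (sle a).
have h2 := ler_wpM2r (onem_cos_ge0 a) (sle b).
apply: (le_trans (lerD h1 h2)).
rewrite -subr_ge0 [X in 0 <= X](_ : _ = 0)//.
by field; rewrite gt_eqF.
Qed.

(* Centering [<u, x>] and [<v, x>] at the arguments of their characteristic
   functions makes the phase of [E e^{i(U + V)}] comparable with
   [E (1 - cos U) (1 - cos V)]. *)
Lemma charfun_centered rho u v eta : 0 < eta ->
  let m w := Normc.normc (charfun rho w) in
  exists D G : R, exists w : R[i], [/\ Normc.normc w = 1,
    charfun rho (u + v) = (D +i* G) * w,
    charfun rho u * charfun rho v = (m u * m v)%:C * w,
    1 - D <= 2 * ((1 - m u) + (1 - m v)) &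
    `|G| <= eta / 2 * ((1 - m u) + (1 - m v)) +
      2 / eta * ((1 - m u) + (1 - m v)
                 - 2^-1 * ((1 - m (u + v)) + (1 - m (u - v))))].
Proof.
move=> eta0 m.
have [al alE] := polar (charfun rho u).
have [be beE] := polar (charfun rho v).
pose U x := dotv u x - al; pose V x := dotv v x - be.
have mU : measurable_fun [set: 'rV[R]_n] U.
  by apply: measurable_funB => //; exact: measurable_dotv.
have mV : measurable_fun [set: 'rV[R]_n] V.
  by apply: measurable_funB => //; exact: measurable_dotv.
have cis1 (g : R) : (cos g +i* sin g) * (cos g -i* sin g) = 1.
  have := cos2Dsin2 g; move: (cos g) (sin g) => c s cs.
  apply/eqP; rewrite eq_complex /=; apply/andP; split; apply/eqP; last by ring.
  by rewrite -[RHS]cs; ring.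
have ncis (g : R) : Normc.normc (cos g +i* sin g) = 1.
  by rewrite /= cos2Dsin2 sqrtr1.
have ncisN (g : R) : Normc.normc (cos g -i* sin g) = 1.
  by rewrite -sinN -cosN ncis.
have [EcU EsU] : \int[rho]_x cos (U x) = m u /\ \int[rho]_x sin (U x) = 0.
  have := shifted_charfun rho u al; rewrite {1}alE -mulrA cis1 mulr1.
  by case.
have [EcV EsV] : \int[rho]_x cos (V x) = m v /\ \int[rho]_x sin (V x) = 0.
  have := shifted_charfun rho v be; rewrite {1}beE -mulrA cis1 mulr1.
  by case.
pose D := \int[rho]_x cos (U x + V x); pose G := \int[rho]_x sin (U x + V x).
pose D' := \int[rho]_x cos (U x - V x).
have DG : D +i* G = charfun rho (u + v) * (cos (al + be) -i* sin (al + be)).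
  rewrite -shifted_charfun; congr (_ +i* _); apply: eq_Rintegral => x _;
    by rewrite dotvDl /U /V opprD addrACA.
have D_le : D <= m (u + v).
  have := ler_Re_normc (D +i* G).
  by rewrite {2}DG Normc.normcM ncisN mulr1.
have D'_le : D' <= m (u - v).
  have := ler_Re_normc (charfun rho (u - v) * (cos (al - be) -i* sin (al - be))).
  rewrite Normc.normcM ncisN mulr1 -shifted_charfun /=.
  congr (_ <= _); apply: eq_Rintegral => x _.
  by rewrite dotvDl dotvNl /U /V; congr cos; ring.
have bcU := bm_cos mU; have bcV := bm_cos mV.
have b1U : bounded_measurable (fun x => 1 - cos (U x)).
  by apply: bmB => //; exact: bmC.
have b1V : bounded_measurable (fun x => 1 - cos (V x)).
  by apply: bmB => //; exact: bmC.
have bcD : bounded_measurable (fun x => cos (U x + V x)).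
  by apply: bm_cos; exact: measurable_funD.
have bcB : bounded_measurable (fun x => cos (U x - V x)).
  by apply: bm_cos; exact: measurable_funB.
have E1U : \int[rho]_x (1 - cos (U x)) = 1 - m u.
  by rewrite ERB ?ERC ?EcU//; exact: bmC.
have E1V : \int[rho]_x (1 - cos (V x)) = 1 - m v.
  by rewrite ERB ?ERC ?EcV//; exact: bmC.
have EUV : \int[rho]_x ((1 - cos (U x)) * (1 - cos (V x))) =
    (1 - m u) + (1 - m v) - 2^-1 * ((1 - D) + (1 - D')).
  transitivity (\int[rho]_x ((1 - cos (U x)) + (1 - cos (V x)) +
      2^-1 * (cos (U x + V x) + cos (U x - V x)) - 1)).
    by apply: eq_Rintegral => x _; rewrite cosD cosB; field.
  have bZ : bounded_measurable
      (fun x => 2^-1 * (cos (U x + V x) + cos (U x - V x))).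
    by apply: bmM; [exact: bmC|exact: bmD].
  rewrite (ERB _ (bmD (bmD b1U b1V) bZ) (bmC _ 1)) (ERD _ (bmD b1U b1V) bZ).
  rewrite (ERD _ b1U b1V) E1U E1V (ERZ _ _ (bmD bcD bcB)) (ERD _ bcD bcB) ERC.
  by rewrite -/D -/D'; field.
exists D, G, ((cos al +i* sin al) * (cos be +i* sin be)); split.
- by rewrite Normc.normcM !ncis mulr1.
- rewrite DG -mulrA [X in _ * X](_ : _ = 1) ?mulr1//.
  have -> : (cos al +i* sin al) * (cos be +i* sin be) =
      cos (al + be) +i* sin (al + be).
    by rewrite cosD sinD; simpc; congr (_ +i* _); rewrite addrC.
  by rewrite mulrC cis1.
- by rewrite {1}alE {1}beE mulrACA -rmorphM.
- rewrite mulrDr -E1U -E1V -!ERZ// -ERD; [|by apply: bmM => //; exact: bmC..].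
  rewrite -[X in X - _](ERC rho) -ERB//; last exact: bmC.
  apply: ER_le; [by apply: bmB => //; exact: bmC| |by move=> x; exact: onem_cosD_le].
  by apply: bmD; apply: bmM => //; exact: bmC.
- have bsU := bm_sin mU; have bsV := bm_sin mV.
  have bsD : bounded_measurable (fun x => sin (U x + V x)).
    by apply: bm_sin; exact: measurable_funD.
  (* By centering, sin U and sin V have mean 0. Subtracting them leaves the integrand of
     [sin_cross_le]. *)
  have -> : G = \int[rho]_x (sin (U x + V x) - sin (U x) - sin (V x)).
    by rewrite ERB//; [rewrite ERB// EsU EsV !subr0|exact: bmB].
  have bT : bounded_measurable
      (fun x => sin (U x + V x) - sin (U x) - sin (V x)).
    by apply: bmB => //; exact: bmB.
  apply: (le_trans (ER_norm _ bT)).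
  apply: (@le_trans _ _ (\int[rho]_x (eta / 2 * ((1 - cos (U x)) +
      (1 - cos (V x))) + 2 / eta * ((1 - cos (U x)) * (1 - cos (V x)))))).
    apply: ER_le; [exact: bm_norm| |by move=> x; exact: sin_cross_le].
    apply: bmD; apply: bmM => //; [exact: bmC|exact: bmD|exact: bmC|exact: bmM].
  rewrite ERD; last 2 first.
  + by apply: bmM; [exact: bmC|exact: bmD].
  + by apply: bmM; [exact: bmC|exact: bmM].
  rewrite ERZ; last exact: bmD.
  rewrite ERZ; last exact: bmM.
  rewrite ERD// E1U E1V EUV lerD2l ler_pM2l ?divr_gt0//.
  rewrite lerD2l lerN2 ler_pM2l ?invr_gt0//.
  by rewrite lerD// lerD2l lerN2.
Qed.

(** For the root of order k + 1 both terms share the unit factor w. What remains is the distance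
    from (D + iG)^(k+1) to the same power of its modulus, at most (k + 1) 2 |G|; the bound on it
    from [charfun_centered] converges to the right side. *)
Lemma id_charfun_phase (phi : 'rV[R]_n -> R[i]) u v eta :
  id_charfun phi -> 0 < eta ->
  Normc.normc (phi (u + v) -
      (expR (cross2 phi u v / 2))%:C * (phi u * phi v)) <=
  eta / 2 * (symexp phi u + symexp phi v) + 2 / eta * cross4 phi u v.
Proof.
move=> ID eta0.
pose K (k : nat) (w : R) := k.+1%:R * (1 - expR (- w / k.+1%:R)).
(* The exponent of the modulus is half that of [sqmod]. *)
pose h w := symexp phi w / 2.
pose F k := 2 * (eta / 2 * (K k (h u) + K k (h v)) +
   2 / eta * (K k (h u) + K k (h v) - 2^-1 * (K k (h (u + v)) + K k (h (u - v))))).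
have Fcvg : F @ \oo --> eta / 2 * (symexp phi u + symexp phi v) +
    2 / eta * cross4 phi u v.
  have -> : eta / 2 * (symexp phi u + symexp phi v) + 2 / eta * cross4 phi u v =
      2 * (eta / 2 * (h u + h v) +
        2 / eta * (h u + h v - 2^-1 * (h (u + v) + h (u - v)))).
    by rewrite /h /cross4; field; rewrite gt_eqF.
  have cK w : K k w @[k --> \oo] --> w by exact: cvg_rootB.
  apply: cvgM; first exact: cvg_cst.
  apply: cvgD; (apply: cvgM; first exact: cvg_cst).
    exact: cvgD.
  by apply: cvgB; [exact: cvgD|apply: cvgM; [exact: cvg_cst|exact: cvgD]].
apply: (ler_cvg_to (cvg_cst _) Fcvg).
have cvg0 w : 1 - expR (- w / k.+1%:R) @[k --> \oo] --> (0 : R).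
  rewrite -(subrr (1 : R)); apply: cvgB; first exact: cvg_cst.
  rewrite -{2}expR0; apply: continuous_cvg; first exact: continuous_expR.
  rewrite -(mulr0 (- w)); apply: cvgM; first exact: cvg_cst.
  exact: cvg_harmonic.
near=> k.
have [rho rhoE rhoS] := id_charfun_root k ID.
have mE w : Normc.normc (charfun rho w) = expR (- h w / k.+1%:R).
  rewrite normc_sqrt rhoS -[RHS]ger0_norm ?expR_ge0// -sqrtr_sqr.
  by rewrite -expRM_natl /h; congr (Num.sqrt (expR _)); field.
have [D [G [w [w1 uvE uEvE D1 GE]]]] := charfun_centered rho u v eta0.
move: D1 GE; rewrite !mE => D1 GE.
(* For large k the moduli of the root at u and v are within 1/4 of 1, and then [D1] gives 1 - D <=
   1. *)
have D0 : 0 <= D.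
  suff : 2 * (1 - expR (- h u / k.+1%:R) + (1 - expR (- h v / k.+1%:R))) <= 1.
    by lra.
  have : 1 - expR (- h u / k.+1%:R) <= 4^-1.
    by near: k; apply: (cvgr_le _ (cvg0 (h u))).
  have : 1 - expR (- h v / k.+1%:R) <= 4^-1.
    by near: k; apply: (cvgr_le _ (cvg0 (h v))).
  lra.
have nDG : Normc.normc (D +i* G) = expR (- h (u + v) / k.+1%:R).
  by rewrite -mE uvE Normc.normcM w1 mulr1.
have e1 t : expR (- h t / k.+1%:R) <= 1.
  rewrite -expR0 ler_expR mulNr oppr_le0 divr_ge0// /h divr_ge0//.
  exact: symexp_ge0.
rewrite !rhoE uvE -(exprMn _ (charfun rho u)) uEvE !exprMn.
rewrite [X in Normc.normc X](_ : _ =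
  ((D +i* G) ^+ k.+1 - (Normc.normc (D +i* G))%:C ^+ k.+1) * w ^+ k.+1).
  rewrite Normc.normcM normcX w1 expr1n mulr1.
  apply: (le_trans (@normc_subXX _ _ _ _ _ _)).
  - by rewrite nDG.
  - by rewrite normc_real nDG// expR_ge0.
  apply: (@le_trans _ _ (k.+1%:R * (2 * `|G|))).
    by rewrite ler_pM2l//; exact: normc_subRe_le.
  rewrite /F mulrCA ler_pM2l//.
  have := ler_wpM2l (ler0n R k.+1) GE; move/le_trans; apply.
  by rewrite /K -subr_ge0 [X in 0 <= X](_ : _ = 0)//; ring.
rewrite [RHS]mulrBl mulrA; congr (_ - _); congr (_ * _).
rewrite -!rmorphXn -rmorphM; congr (_%:C).
rewrite nDG !mE -!expRD -!expRM_natl -expRD /cross2 /h.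
by congr expR; field.
Unshelve. all: by end_near. Qed.

End phase.

(** * The exponent of the one-point law *)

Section cosine.
Context (R : realType).
Implicit Types y : R.

Lemma onem_cos_le_sqr y : 1 - cos y <= y ^+ 2.
Proof.
have sin_le (t : R) : 0 <= t -> `|sin t| <= t.
  move=> t0; have [c _] := @MVT_segment R sin cos 0 t t0
    (fun x _ => is_derive_sin x) (continuous_subspaceT (@continuous_sin R)).
  rewrite sin0 !subr0 => ->; rewrite normrM (ger0_norm t0).
  by rewrite ler_piMl// cos_max.
have s2 : `|sin y| <= `|y|.
  have := sin_le `|y| (normr_ge0 y).
  by have [y0|y0] := ger0P y; rewrite ?sinN ?normrN.
have [y1|y1] := lerP 0 (cos y).
  apply: (@le_trans _ _ (sin y ^+ 2)).
    rewrite sin2cos2 -subr_ge0 [X in 0 <= X](_ : _ = cos y * (1 - cos y)).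
      by rewrite mulr_ge0// onem_cos_ge0.
    by ring.
  by rewrite -[X in X <= _]real_normK ?num_real// -[X in _ <= X]real_normK
    ?num_real// ler_sqr ?nnegrE.
have [c cin] := @MVT_segment R cos (fun x => - sin x) 0 `|y| (normr_ge0 y)
    (fun x _ => is_derive_cos x) (continuous_subspaceT (@continuous_cos R)).
rewrite cos0 subr0 cos_norm => cE.
have -> : 1 - cos y = sin c * `|y| by rewrite -opprB cE mulNr opprK.
rewrite -[X in _ <= X]real_normK ?num_real// expr2 ler_wpM2r//.
move: cin; rewrite in_itv/= => /andP[c0 cy].
by rewrite (le_trans _ cy)// (le_trans (ler_norm _))// sin_le.
Qed.

(** Rewrites membership in the lattice as an equation for cos, the form in which [tailpoly] detects
    it. *)
Lemma cos_eq1 y : cos y = 1 <-> exists z : int, y = 2 * pi * z%:~R.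
Proof.
have p2 : pi *+ 2 = 2 * pi :> R by rewrite mulr_natl.
have cosn (t : R) (k : nat) : cos (t + 2 * pi * k%:R) = cos t.
  by rewrite -p2 mulr_natr (periodicn (@cosD2pi R)).
have cosz (t : R) (z : int) : cos (t + 2 * pi * z%:~R) = cos t.
  case: z => k; first exact: cosn.
  rewrite NegzE mulrNz mulrN -cosN opprD opprK -pmulrn.
  by rewrite cosn cosN.
split=> [cy|[z ->]]; last by rewrite -[X in cos X]add0r cosz cos0.
have pi0 := pi_gt0 R.
have tp : 0 < 2 * pi :> R by rewrite mulr_gt0.
pose z := Num.floor (y / (2 * pi)).
exists z.
pose r := y - 2 * pi * z%:~R.
suff : r = 0 by move=> /eqP; rewrite subr_eq0 => /eqP.
have r0 : 0 <= r.
  by rewrite subr_ge0 mulrC -ler_pdivlMr// floor_le.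
have r1 : r < 2 * pi.
  rewrite ltrBlDr -[X in _ < X + _]mulr1 -mulrDr mulrC -ltr_pdivrMr//.
  by have := floorD1_gt (y / (2 * pi)); rewrite -/z intrD addrC.
have cr : cos r = 1.
  by rewrite -cy -(cosz r z) /r subrK.
have key (t : R) : 0 <= t -> t <= pi -> cos t = 1 -> t = 0.
  move=> t0 tpi ct; apply: cos_inj; rewrite ?in_itv/= ?t0 ?lexx ?tpi ?ltW//.
  by rewrite ct cos0.
have [rpi|rpi] := leP r pi; first exact: key.
suff : 2 * pi - r = 0 by move=> /eqP; rewrite subr_eq0 => /eqP h; move: r1; rewrite h ltxx.
apply: key; first by rewrite subr_ge0 ltW.
  by rewrite lerBlDr mulrDl mul1r lerD2l ltW.
rewrite cosB -p2 cos2pi sin2pi mul0r addr0 mul1r//.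
Qed.

End cosine.

Section levy_exponent_modulus.
Context (R : realType) (n : nat).
Implicit Types (theta x a b : 'rV[R]_n) (Q : {measure set 'rV[R]_n -> \bar R}).

Lemma dotv_ge0 x : 0 <= dotv x x.
Proof. by apply: sumr_ge0 => i _; rewrite -expr2 sqr_ge0. Qed.

(** Cauchy-Schwarz, from the squared norm of [theta] minus its projection on [x]. *)
Lemma dotv_sqr_le theta x : dotv theta x ^+ 2 <= dotv theta theta * dotv x x.
Proof.
have [x0|x0] := eqVneq (dotv x x) 0.
  suff -> : x = 0 by rewrite !dotv0r expr0n mulr0.
  apply/rowP => i; rewrite mxE; apply/eqP; rewrite -sqrf_eq0 expr2; apply/eqP.
  by apply: (psumr_eq0P (P := xpredT)) x0 _ _ => // j _; rewrite -expr2 sqr_ge0.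
have xp : 0 < dotv x x by rewrite lt_neqAle eq_sym x0 dotv_ge0.
set t := dotv theta x / dotv x x.
have := dotv_ge0 (theta + (- t) *: x).
have dotvZr y z (c : R) : dotv y (c *: z) = c * dotv y z.
  by rewrite dotvC dotvZl dotvC.
rewrite dotvDl !dotvDr !dotvZr !dotvZl (dotvC x theta).
rewrite -(ler_pM2r xp) mul0r => h.
by rewrite -subr_ge0; move: h; congr (_ <= _); rewrite /t; field.
Qed.

Lemma onem_cos_integrable Q theta : levy_integrable Q ->
  Q.-integrable [set: 'rV[R]_n] (EFin \o (fun x => 1 - cos (dotv theta x))).
Proof.
move=> [_ Qoo].
have mdot : measurable_fun [set: 'rV[R]_n] (fun x : 'rV[R]_n => dotv x x).
  by apply: measurable_sum => i; apply: measurable_funM; exact: measurable_coord.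
have m0 x : 0 <= Num.min 1 (dotv x x) by rewrite le_min ler01 dotv_ge0.
have iQ : Q.-integrable [set: 'rV[R]_n] (EFin \o (fun x => Num.min 1 (dotv x x))).
  apply/integrableP; split.
    by apply/measurable_EFinP; exact: measurable_minr.
  by under eq_integral do rewrite /= ger0_norm//.
(* The summand 2 serves where |x| >= 1, and |theta|^2 where |x| < 1. *)
pose C := 2 + dotv theta theta.
have C0 : 0 <= C by rewrite addr_ge0// dotv_ge0.
have : Q.-integrable [set: 'rV[R]_n]
    (EFin \o (fun x => C * Num.min 1 (dotv x x))).
  rewrite (_ : _ \o _ = fun x => C%:E * (Num.min 1 (dotv x x))%:E)%E.
    exact: integrableZl.
  by apply/funext => x /=; rewrite EFinM.
apply: le_integrable => //.
  apply/measurable_EFinP; apply: measurable_funB => //.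
  by have [] := bm_cos_dotv theta.
move=> x _ /=; rewrite lee_fin ger0_norm ?onem_cos_ge0// ger0_norm ?mulr_ge0//.
have [h|h] := leP 1 (dotv x x).
  rewrite mulr1 /C; have := cos_geN1 (dotv theta x); have := dotv_ge0 theta; lra.
apply: (le_trans (onem_cos_le_sqr _)); apply: (le_trans (dotv_sqr_le _ _)).
by rewrite ler_wpM2r ?dotv_ge0// /C lerDr.
Qed.

(** Drift and compensator only contribute to the imaginary part of the exponent. The Gaussian form
    is recorded through its parallelogram law, which is what the product rule [trigpoly_jetM]
    uses. *)
Lemma symexp_levy (mu : probability 'rV[R]_n R) Q : is_levy_measure mu Q ->
  exists q : 'rV[R]_n -> R, [/\ q 0 = 0,
    forall a b, q (a + b) + q (a - b) = 2 * (q a + q b) &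
    forall theta, symexp (charfun mu) theta =
      q theta + 2 * \int[Q]_x (1 - cos (dotv theta x))].
Proof.
move=> [lQ [gamma [Sigma [_ _ muE]]]].
pose q theta := dotv (theta *m Sigma) theta.
exists q; split.
- by rewrite /q mul0mx dotv0l.
- move=> a b; rewrite /q !mulmxDl !dotvDl !dotvDr mulNmx.
  by rewrite !dotvNl !(dotvC _ (- b)) !dotvNl !(dotvC b); ring.
- move=> theta; rewrite /symexp muE.
  have sE (z : R[i]) : sqmod (cexp z) = expR (2 * complex.Re z).
    rewrite sqmodM {2}/sqmod/= cos2Dsin2 mulr1 /sqmod/= expr0n addr0.
    by rewrite expRM_natl.
  rewrite sE expRK /levy_exponent.
  have -> : complex.Re ('i * (dotv theta gamma)%:C -
      (2^-1 * dotv (theta *m Sigma) theta)%:C + cintegral Q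
      (fun x => cexp ('i * (dotv theta x)%:C) - 1 -
       'i * (if dotv x x <= 1 then dotv theta x else 0)%:C)) =
      - (2^-1 * q theta) - \int[Q]_x (1 - cos (dotv theta x)).
    rewrite /cintegral; simpc => /=.
    have -> : \int[Q]_x complex.Re (cexp ('i * (dotv theta x)%:C) - 1 -
       'i * (if dotv x x <= 1 then dotv theta x else 0)%:C) =
       \int[Q]_x (- 1 * (1 - cos (dotv theta x))).
      apply: eq_Rintegral => x _; rewrite cexp_i; simpc => /=; ring.
    rewrite RintegralZl//; last exact: onem_cos_integrable.
    by rewrite /q; ring.
  by field.
Qed.

End levy_exponent_modulus.

Section trigpoly_algebra.
Context (R : realType) (n : nat) (q : 'rV[R]_n -> R).
Hypothesis q0 : q 0 = 0.
Hypothesis qD : forall a b, q (a + b) + q (a - b) = 2 * (q a + q b).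
Implicit Types (f g : 'rV[R]_n -> R) (theta : 'rV[R]_n).

(* [e] is, up to sign, the second derivative of [f] at [0] that is associated
   with the quadratic form [q]. *)
Definition trigpoly_jet f e := exists s : seq (R * 'rV[R]_n),
  (forall x, f x = trigpoly s x) /\ e = \sum_(p <- s) p.1 * q p.2.

Lemma trigpoly_jetC c : trigpoly_jet (fun=> c) 0.
Proof.
exists [:: (c, 0)]; split=> [x|].
  by rewrite /trigpoly big_cons big_nil/= dotv0l cos0 mulr1 addr0.
by rewrite big_cons big_nil/= q0 mulr0 addr0.
Qed.

Lemma trigpoly_jet_cos theta : trigpoly_jet (fun x => cos (dotv theta x)) (q theta).
Proof.
exists [:: (1, theta)]; split=> [x|].
  by rewrite /trigpoly big_cons big_nil/= mul1r addr0.
by rewrite big_cons big_nil/= mul1r addr0.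
Qed.

Lemma trigpoly_jetD f g e e' : trigpoly_jet f e -> trigpoly_jet g e' ->
  trigpoly_jet (fun x => f x + g x) (e + e').
Proof.
move=> [s [fE ->]] [s' [gE ->]]; exists (s ++ s'); split=> [x|].
  by rewrite fE gE /trigpoly big_cat.
by rewrite big_cat.
Qed.

(** A Leibniz rule without mixed term, since first derivatives of cosine polynomials vanish at 0. On
    coefficients it is the product-to-sum formula combined with the parallelogram law of [q]. *)
Lemma trigpoly_jetM f g e e' : trigpoly_jet f e -> trigpoly_jet g e' ->
  trigpoly_jet (fun x => f x * g x) (f 0 * e' + e * g 0).
Proof.
move=> [s [fE ->]] [s' [gE ->]].
exists ([seq (p.1 * p'.1 / 2, p.2 + p'.2) | p <- s, p' <- s'] ++
        [seq (p.1 * p'.1 / 2, p.2 - p'.2) | p <- s, p' <- s']); split=> [x|].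
  rewrite /trigpoly big_cat/= !big_allpairs_dep/= -big_split/= fE gE/=.
  rewrite mulr_suml; apply: eq_bigr => p _.
  rewrite mulr_sumr -big_split; apply: eq_bigr => p' _ /=.
  by rewrite !dotvDl dotvNl cosD cosB; field.
rewrite big_cat/= !big_allpairs_dep/= -big_split/= fE gE/= /trigpoly.
rewrite !mulr_suml -big_split; apply: eq_bigr => p _ /=.
rewrite !mulr_sumr -!big_split; apply: eq_bigr => p' _ /=.
rewrite !dotv0r cos0 !mulr1.
by rewrite -mulrDr qD; field.
Qed.

Lemma trigpoly_jetZ c f e : trigpoly_jet f e ->
  trigpoly_jet (fun x => c * f x) (c * e).
Proof.
by move=> fe; have := trigpoly_jetM (trigpoly_jetC c) fe; rewrite mul0r addr0.
Qed.

(** The value of the jet is left open: in [symexp_tailpoly] it gets multiplied by (1 - cos 0)^2 =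
    0. *)
Lemma trigpoly_jetX f e k : trigpoly_jet f e ->
  exists e', trigpoly_jet (fun x => f x ^+ k) e'.
Proof.
move=> fe; elim: k => [|k [e' IH]].
  by exists 0; under eq_fun do rewrite expr0; exact: trigpoly_jetC.
by eexists; under eq_fun do rewrite exprS; exact: trigpoly_jetM fe IH.
Qed.

End trigpoly_algebra.

(* As [k] grows, [tailpoly theta e k] decreases to
   [(1 - cos <theta, x>)^2] on the set where [<e, x>] is in [2 pi Z]. *)
Definition tailpoly (R : realType) n (theta e : 'rV[R]_n) k (x : 'rV[R]_n) :=
  (1 - cos (dotv theta x)) ^+ 2 * ((1 + cos (dotv e x)) / 2) ^+ k.

Lemma tailpoly_coef0 (R : realType) n (theta e : 'rV[R]_n) k
    (s : seq (R * 'rV[R]_n)) :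
  (forall x, tailpoly theta e k x = trigpoly s x) -> \sum_(p <- s) p.1 = 0.
Proof.
move=> /(_ 0); rewrite /tailpoly dotv0r cos0 subrr expr0n mul0r => {2}->.
by apply: eq_bigr => p _; rewrite dotv0r cos0 mulr1.
Qed.

Section levy_tail.
Context (R : realType) (n : nat).
Variables (mu : probability 'rV[R]_n R) (Q : {measure set 'rV[R]_n -> \bar R}).
Hypothesis muQ : is_levy_measure mu Q.

(* [tailpoly] vanishes to fourth order at [0], so the Gaussian part does not
   contribute. *)
Lemma symexp_tailpoly theta e k : exists s : seq (R * 'rV[R]_n),
  (forall x, tailpoly theta e k x = trigpoly s x) /\
  - \sum_(p <- s) p.1 * symexp (charfun mu) p.2 =
  2 * \int[Q]_x tailpoly theta e k x.
Proof.
have [q [q0 qD muE]] := symexp_levy muQ.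
have j1 : trigpoly_jet q (fun x => 1 - cos (dotv theta x)) (0 + -1 * q theta).
  have := trigpoly_jetD (trigpoly_jetC q0 1)
    (trigpoly_jetZ q0 qD (-1) (trigpoly_jet_cos q theta)).
  by under eq_fun do rewrite mulN1r.
have [e' j2] := trigpoly_jetX q0 qD k (trigpoly_jetZ q0 qD (2^-1)
  (trigpoly_jetD (trigpoly_jetC q0 1) (trigpoly_jet_cos q e))).
have := trigpoly_jetM qD (trigpoly_jetM qD j1 j1) j2.
rewrite !dotv0r cos0 subrr !mul0r mulr0 !addr0 mul0r addr0.
move=> [s [sT s0]]; exists s.
have {}sT x : tailpoly theta e k x = trigpoly s x.
  by rewrite -sT /tailpoly expr2 [X in _ * X ^+ k]mulrC.
split=> //.
have sc := tailpoly_coef0 sT.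
have [lQ _] := muQ.
have iQ (p : R * 'rV[R]_n) : Q.-integrable [set: 'rV[R]_n]
    (EFin \o (fun x => p.1 * (1 - cos (dotv p.2 x)))).
  rewrite (_ : _ \o _ = fun x => (p.1)%:E * (1 - cos (dotv p.2 x))%:E)%E.
    by apply: integrableZl => //; exact: onem_cos_integrable.
  by apply/funext => x /=; rewrite EFinM.
transitivity (- 2 * \int[Q]_x \sum_(p <- s) p.1 * (1 - cos (dotv p.2 x))).
  have -> : \int[Q]_x \sum_(p <- s) p.1 * (1 - cos (dotv p.2 x)) =
      \sum_(p <- s) p.1 * \int[Q]_x (1 - cos (dotv p.2 x)).
    elim: (s) => [|p s' IH].
      under eq_Rintegral do rewrite big_nil.
      by rewrite big_nil Rintegral_cst// mul0r.
    under eq_Rintegral do rewrite big_cons.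
    rewrite RintegralD//; last first.
      rewrite (_ : _ \o _ = fun x =>
          \sum_(i <- s') (i.1 * (1 - cos (dotv i.2 x)))%:E)%E.
        by apply: integrable_sum => // i _; exact: iQ.
      by apply/funext => x /=; rewrite sumEFin.
    by rewrite IH big_cons RintegralZl//; exact: onem_cos_integrable.
  rewrite mulNr mulr_sumr; congr (- _).
  transitivity (\sum_(p <- s) (p.1 * q p.2 +
      2 * (p.1 * \int[Q]_x (1 - cos (dotv p.2 x))))).
    by apply: eq_bigr => p _; rewrite muE; ring.
  by rewrite big_split/= -s0 add0r.
rewrite mulNr -mulrN; congr (_ * _).
transitivity (-1 * \int[Q]_x \sum_(p <- s) p.1 * (1 - cos (dotv p.2 x))).
  by rewrite mulN1r.
rewrite -RintegralZl//; last first.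
  rewrite (_ : _ \o _ = fun x =>
      \sum_(i <- s) (i.1 * (1 - cos (dotv i.2 x)))%:E)%E.
    by apply: integrable_sum => // i _; exact: iQ.
  by apply/funext => x /=; rewrite sumEFin.
apply: eq_Rintegral => x _; rewrite sT /trigpoly mulN1r.
under eq_bigr do rewrite mulrBr mulr1.
by rewrite sumrB sc sub0r opprK.
Qed.

(** Dominated convergence: the pointwise limit lives on the Q-null set where cos <e, x> = 1, and 2
    (1 - cos <theta, x>) is an integrable majorant for all k. *)
Lemma tailpoly_vanishes theta e :
  Q [set x | cos (dotv e x) = 1] = 0%E ->
  \int[Q]_x tailpoly theta e k x @[k --> \oo] --> (0 : R).
Proof.
move=> Qe; have [lQ _] := muQ.
pose f x := if cos (dotv e x) == 1 then (1 - cos (dotv theta x)) ^+ 2 else 0.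
have mc b : measurable_fun [set: 'rV[R]_n] (fun x => cos (dotv b x)).
  by have [] := bm_cos_dotv b.
have mT k : measurable_fun [set: 'rV[R]_n] (tailpoly theta e k).
  apply: measurable_funM; apply: measurable_funX.
    exact: measurable_funB.
  by apply: measurable_funM => //; exact: measurable_funD.
have ce x : 0 <= (1 + cos (dotv e x)) / 2 <= 1.
  by have := cos_geN1 (dotv e x); have := cos_le1 (dotv e x); lra.
have cvgT x : tailpoly theta e k x @[k --> \oo] --> f x.
  rewrite /f /tailpoly; case: eqP => [->|/eqP c1].
    have -> : (1 + 1) / 2 = 1 :> R by field.
    under eq_cvg do rewrite expr1n mulr1.
    exact: cvg_cst.
  rewrite -[X in _ --> X](mulr0 ((1 - cos (dotv theta x)) ^+ 2)).
  apply: cvgM; first exact: cvg_cst.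
  have /andP[h0 h1] := ce x.
  apply: cvg_expr; rewrite ger0_norm// lt_neqAle h1 andbT.
  by apply: contra_neq c1 => h; lra.
have Tle k x : `|tailpoly theta e k x| <= 2 * (1 - cos (dotv theta x)).
  have h0 := onem_cos_ge0 (dotv theta x); have h1 := cos_geN1 (dotv theta x).
  have /andP[h2 h3] := ce x.
  rewrite /tailpoly ger0_norm; last by rewrite mulr_ge0// exprn_ge0.
  apply: (@le_trans _ _ ((1 - cos (dotv theta x)) ^+ 2)).
    by rewrite ler_piMr ?sqr_ge0// exprn_ile1.
  by rewrite expr2 ler_wpM2r//; lra.
have i2 : Q.-integrable [set: 'rV[R]_n]
    (EFin \o (fun x => 2 * (1 - cos (dotv theta x)))).
  rewrite (_ : _ \o _ = fun x => 2%:E * (1 - cos (dotv theta x))%:E)%E.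
    by apply: integrableZl => //; exact: onem_cos_integrable.
  by apply/funext => x /=; rewrite EFinM.
have := cvg_Rintegral_dominated mT cvgT i2 Tle.
suff -> : \int[Q]_x f x = 0 by [].
have mf : measurable_fun [set: 'rV[R]_n] f.
  by apply: (measurable_fun_cvg mT) => x _; exact: cvgT.
have mN : measurable [set x | cos (dotv e x) = 1].
  have := mc e measurableT [set 1] (measurable_set1 _); rewrite setTI.
  by congr measurable.
have -> : 0 = \int[Q]_x (cst 0 : 'rV[R]_n -> R) x.
  by rewrite Rintegral_cst// mul0r.
congr fine; apply: ae_eq_integral => //.
- exact/measurable_EFinP.
- exact/measurable_EFinP.
- exists [set x | cos (dotv e x) = 1]; split => // x /= h.
  by apply: contrapT => ce1; apply: h => _; rewrite /f; case: eqP.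
Qed.

End levy_tail.

(** * Asymptotic independence *)

Section cross4_tail.
Context (R : realType) (N d : nat) (phi : 'rV[R]_N -> R[i]).
Hypothesis ID : id_charfun phi.
Variables (io : 'rV[R]_d -> 'rV[R]_N) (pr : 'rV[R]_N -> 'rV[R]_d).
Hypothesis ioE : forall theta x, dotv (io theta) x = dotv theta (pr x).
Local Notation psi := (symexp phi).

Lemma symexpN u : psi (- u) = psi u.
Proof.
suff h w : psi w <= psi (- w).
  by apply/eqP; rewrite eq_le h andbT; have := h (- u); rewrite opprK.
have := @symexp_trigpoly _ _ phi [:: (1, w); (-1, - w)] ID.
rewrite !big_cons !big_nil/= => h.
suff : 1 * psi w + (-1 * psi (- w) + 0) <= 0 by lra.
apply: h; last by ring.
move=> x; rewrite /trigpoly !big_cons big_nil/= dotvNl cosN.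
by rewrite mul1r mulN1r addr0 subrr.
Qed.

(** With p = 1 - cos a, the bound p <= eta / 2 + p^2 / (2 eta) produces the square that [tailpoly]
    needs. Then 1 = T + (1 - T) with T = ((1 + cos c) / 2)^k: the part with T is a [tailpoly], and 1
    - T <= k (1 - cos c) / 2 by Bernoulli. *)
Lemma tailpoly_le (a b c eta : R) (k : nat) : 0 < eta ->
  (1 - cos a) * (1 - cos b) <= eta / 2 * (1 - cos b) +
    eta^-1 * ((1 - cos a) ^+ 2 * ((1 + cos c) / 2) ^+ k) +
    k%:R / eta * ((1 - cos c) * (1 - cos b)).
Proof.
move=> eta0; set t := (1 + cos c) / 2.
have t0 : 0 <= t by rewrite /t; have := cos_geN1 c; lra.
have t1 : t <= 1 by rewrite /t; have := cos_le1 c; lra.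
have bernoulli : 1 - t ^+ k <= k%:R * (1 - t).
  elim: (k) => [|j IH]; first by rewrite expr0 subrr mul0r.
  rewrite exprS -addn1 natrD mulrDl mul1r.
  have -> : 1 - t * t ^+ j = (1 - t ^+ j) + t ^+ j * (1 - t) by ring.
  rewrite lerD//.
  by rewrite ler_piMl ?subr_ge0// exprn_ile1.
have tE : 1 - t = (1 - cos c) / 2 by rewrite /t; field.
have tk0 : 0 <= t ^+ k by rewrite exprn_ge0.
have tk1 : t ^+ k <= 1 by rewrite exprn_ile1.
have p0 := onem_cos_ge0 a; have q0 := onem_cos_ge0 b.
have p2 : 1 - cos a <= 2 by have := cos_geN1 a; lra.
have q2 : 1 - cos b <= 2 by have := cos_geN1 b; lra.
move: (t ^+ k) bernoulli tk0 tk1; rewrite tE => T hT T0 T1.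
move: (1 - cos a) (1 - cos b) (1 - cos c) p0 q0 p2 q2 hT => p q r p0 q0 p2 q2 hT.
have eV : 0 < eta^-1 by rewrite invr_gt0.
apply: (@le_trans _ _ (eta / 2 * q + eta^-1 / 2 * (p ^+ 2 * q))).
  rewrite -subr_ge0 [X in 0 <= X](_ : _ = eta^-1 / 2 * q * (p - eta) ^+ 2).
    by rewrite mulr_ge0 ?sqr_ge0// mulr_ge0// divr_ge0// ltW.
  by field; rewrite gt_eqF.
rewrite -addrA lerD2l.
have -> : eta^-1 * (p ^+ 2 * T) + k%:R / eta * (r * q) =
  eta^-1 / 2 * (2 * p ^+ 2 * T + 4 * q * (k%:R * (r / 2))).
  by field; rewrite gt_eqF.
rewrite ler_pM2l ?divr_gt0//.
have -> : p ^+ 2 * q = p ^+ 2 * T * q + p ^+ 2 * q * (1 - T) by ring.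
apply: lerD.
  rewrite [X in _ <= X](_ : _ = p ^+ 2 * T * 2); last by ring.
  by rewrite ler_wpM2l// mulr_ge0// sqr_ge0.
have p4 : p ^+ 2 <= 4.
  have -> : 4 = 2 ^+ 2 :> R by ring.
  by rewrite ler_sqr ?nnegrE.
apply: ler_pM => //; last by rewrite ler_wpM2r.
- by rewrite mulr_ge0// sqr_ge0.
- by rewrite subr_ge0.
Qed.

(** [tailpoly_le] read through [symexp_trigpoly]. The three terms become small for different
    reasons: the first by the choice of eta, the second, which sees only the marginal selected by
    [io], by the choice of k, and the third in the limit along the escaping times. *)
Lemma cross4_tail theta e v k (s : seq (R * 'rV[R]_d)) eta : 0 < eta ->
  (forall x, tailpoly theta e k x = trigpoly s x) ->
  cross4 phi (io theta) v <= eta / 2 * psi v +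
    eta^-1 * (- \sum_(p <- s) p.1 * psi (io p.2)) +
    k%:R / eta * cross4 phi (io e) v.
Proof.
move=> eta0 sT; set c := k%:R / eta.
have sc := tailpoly_coef0 sT.
have := @symexp_trigpoly _ _ phi ([:: (eta / 2 + c - 1, 0); (1, io theta);
  (1 - eta / 2 - c, v); (- c, io e); (c / 2, io e + v); (c / 2, io e - v);
  (- 2^-1, io theta + v); (- 2^-1, io theta - v)] ++
  [seq (eta^-1 * p.1, io p.2) | p <- s]) ID.
rewrite /trigpoly !big_cat !big_cons !big_nil/= !big_map/= symexp0// => h.
rewrite -subr_ge0 -oppr_le0.
suff : (eta / 2 + c - 1) * 0 + (1 * psi (io theta) + ((1 - eta / 2 - c) * psi v +
   (- c * psi (io e) + (c / 2 * psi (io e + v) + (c / 2 * psi (io e - v) +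
   (- 2^-1 * psi (io theta + v) + (- 2^-1 * psi (io theta - v) + 0))))))) +
   \sum_(p <- s) eta^-1 * p.1 * psi (io p.2) <= 0.
  have -> : \sum_(p <- s) eta^-1 * p.1 * psi (io p.2) =
      eta^-1 * \sum_(p <- s) p.1 * psi (io p.2).
    by rewrite mulr_sumr; apply: eq_bigr => p _; rewrite mulrA.
  by rewrite /cross4; congr (_ <= _); field; rewrite gt_eqF.
apply: h; last by rewrite -mulr_sumr sc; field; rewrite gt_eqF.
move=> x; rewrite !big_cons !big_map/=.
have -> : \sum_(p <- s) eta^-1 * p.1 * cos (dotv (io p.2) x) =
    eta^-1 * tailpoly theta e k (pr x).
  rewrite sT /trigpoly mulr_sumr; apply: eq_bigr => p _.
  by rewrite ioE mulrA.
have := tailpoly_le (dotv theta (pr x)) (dotv v x) (dotv e (pr x)) k eta0.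
rewrite -/c -subr_ge0 !dotvDl dotvNl !ioE dotv0l cos0 !cosD !cosN !sinN /tailpoly.
by congr (_ <= _); field; rewrite gt_eqF.
Qed.

End cross4_tail.

Section null_sequences.
Context (R : realType).
Implicit Types (f g : nat -> R).

Definition null_seq f := f @ \oo --> (0 : R).

Lemma null_seqD f g : null_seq f -> null_seq g -> null_seq (fun k => f k + g k).
Proof. by move=> f0 g0; rewrite /null_seq -[0]addr0; exact: cvgD. Qed.

Lemma null_seqZ (c : R) f : null_seq f -> null_seq (fun k => c * f k).
Proof.
move=> f0; rewrite /null_seq -(mulr0 c).
by apply: cvgM; [exact: cvg_cst|exact: f0].
Qed.

Lemma null_seqB f g : null_seq f -> null_seq g -> null_seq (fun k => f k - g k).
Proof.
move=> f0 g0; have := null_seqD f0 (null_seqZ (-1) g0).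
by under eq_fun do rewrite mulN1r.
Qed.

Lemma null_seq0 : null_seq (fun=> 0).
Proof. exact: cvg_cst. Qed.

(** The majorant may depend on eps, so auxiliary parameters can be fixed before the index goes to
    infinity. *)
Lemma null_seq_le f :
  (forall eps, 0 < eps ->
    exists2 g, null_seq g & forall k, `|f k| <= eps + `|g k|) ->
  null_seq f.
Proof.
move=> fg; apply/cvgr0Pnorm_le => eps eps0.
have e2 : 0 < eps / 2 by rewrite divr_gt0.
have [g /cvgr0Pnorm_le /(_ _ e2) g0 fle] := fg _ e2.
near=> k; apply: (le_trans (fle k)).
have : `|g k| <= eps / 2 by near: k.
by lra.
Unshelve. all: by end_near. Qed.

Lemma null_seq_squeeze f g : null_seq g -> (forall k, `|f k| <= `|g k|) ->
  null_seq f.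
Proof.
move=> g0 fg; apply: null_seq_le => eps eps0; exists g => // k.
by rewrite (le_trans (fg k))// lerDr ltW.
Qed.

End null_sequences.

Section single_row.
Context (R : realType) (m d : nat).
Implicit Types (a b : 'I_m) (theta : 'rV[R]_d).

Definition single_row a theta : 'M[R]_(m, d) :=
  \matrix_(b, j) (if b == a then theta ord0 j else 0).

Lemma single_row_delta a j : single_row a (delta_mx ord0 j) = delta_mx a j.
Proof. by apply/matrixP => i k; rewrite !mxE/=; case: eqP. Qed.

Lemma row_single_row a b theta :
  row b (single_row a theta) = if b == a then theta else 0.
Proof. by apply/rowP => i; rewrite !mxE; case: eqP; rewrite ?mxE. Qed.

End single_row.

Section asymptotic_independence.
Context (R : realType) (N m d : nat).
Variables (phi : nat -> 'rV[R]_N -> R[i]) (v : 'rV[R]_N) (V : R).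
Variables (emb : 'M[R]_(m, d) -> 'rV[R]_N) (psi : 'M[R]_(m, d) -> R).
Variables (pr : 'I_m -> 'rV[R]_N -> 'rV[R]_d).
Variables (mu : probability 'rV[R]_d R) (Q : {measure set 'rV[R]_d -> \bar R}).
Variables (j0 : 'I_d).

Hypothesis ID : forall k, id_charfun (phi k).
Hypothesis embD : forall A B, emb (A + B) = emb A + emb B.
Hypothesis embZ : forall c A, emb (c *: A) = c *: emb A.
Hypothesis psiV : forall k, symexp (phi k) v = V.
Hypothesis psiE : forall k A, symexp (phi k) (emb A) = psi A.
Hypothesis embE : forall a theta x,
  dotv (emb (single_row a theta)) x = dotv theta (pr a x).
Hypothesis muE : forall a theta,
  psi (single_row a theta) = symexp (charfun mu) theta.
Hypothesis muQ : is_levy_measure mu Q.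
Hypothesis Q0 : Q [set x : 'rV[R]_d | cos (dotv (delta_mx ord0 j0) x) = 1] = 0%E.
Hypothesis cross2_delta : forall a j,
  null_seq (fun k => cross2 (phi k) (emb (delta_mx a j)) v).
Hypothesis cross4_delta : forall a j,
  null_seq (fun k => cross4 (phi k) (emb (delta_mx a j)) v).

Let b A k := cross4 (phi k) (emb A) v.
Let c A k := cross2 (phi k) (emb A) v.

Let V_ge0 : 0 <= V. Proof. by rewrite -(psiV 0); exact: symexp_ge0. Qed.
Let psi_ge0 A : 0 <= psi A.
Proof. by rewrite -(psiE 0); exact: symexp_ge0. Qed.

Let emb0 : emb 0 = 0. Proof. by rewrite -(scale0r 0) embZ scale0r. Qed.

(** The hypotheses concern unit vectors; the one-point Levy measure gives access to every other
    frequency at the same site. Given eps, the choices are made in the order eta, K, index. *)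
Let cross4_single a theta : null_seq (b (single_row a theta)).
Proof.
apply: null_seq_le => eps eps0.
(* V + 1 is positive even when V = 0. With this eta and the tail bound eta * eps / 4, the first two
   terms of [cross4_tail] are at most eps / 2 each. *)
pose eta := eps / (V + 1).
have V1 : 0 < V + 1 by rewrite ltr_pwDr.
have eta0 : 0 < eta by rewrite divr_gt0.
have [K TK] : exists K, \int[Q]_x tailpoly theta (delta_mx ord0 j0) K x <=
    eta * eps / 4.
  have e4 : 0 < eta * eps / 4 by rewrite divr_gt0// mulr_gt0.
  have /cvgr_le/(_ _ e4)[K _ KP] := @tailpoly_vanishes _ _ _ _ muQ theta _ Q0.
  by exists K; exact: (KP K (leqnn K)).
have [s [sT sQ]] := symexp_tailpoly muQ theta (delta_mx ord0 j0) K.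
exists (fun k => K%:R / eta * b (delta_mx a j0) k).
  by apply: null_seqZ; exact: cross4_delta.
move=> k; rewrite ger0_norm; last exact: cross4_ge0.
have := cross4_tail (ID k) (embE a) v eta0 sT; rewrite psiV single_row_delta -/(b _ k).
under eq_bigr do rewrite psiE muE.
rewrite sQ => /le_trans; apply.
have b0 : 0 <= K%:R / eta * b (delta_mx a j0) k.
  by apply: mulr_ge0; [rewrite divr_ge0// ltW|exact: cross4_ge0].
rewrite (ger0_norm b0) lerD2r.
have h1 : eta / 2 * V <= eps / 2.
  rewrite /eta -subr_ge0 [X in 0 <= X](_ : _ = eps / 2 / (V + 1)).
    by rewrite !divr_ge0// ltW.
  by field; rewrite gt_eqF.
have h2 : eta^-1 * (2 * \int[Q]_x tailpoly theta (delta_mx ord0 j0) K x) <= eps / 2.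
  apply: (@le_trans _ _ (eta^-1 * (2 * (eta * eps / 4)))).
    by rewrite ler_pM2l ?invr_gt0// ler_pM2l.
  rewrite -subr_ge0 [X in 0 <= X](_ : _ = 0)//.
  by field; rewrite gt_eqF.
lra.
Qed.

Let cross4_null A : null_seq (b A).
Proof.
have b_add B C : null_seq (b B) -> null_seq (b C) -> null_seq (b (B + C)).
  move=> B0 C0; apply: null_seq_squeeze
    (null_seqD (null_seqZ 2 B0) (null_seqZ 2 C0)) _ => k.
  rewrite ger0_norm; last exact: cross4_ge0.
  by rewrite (le_trans _ (ler_norm _))// /b embD; exact: cross4Dl.
(* The one-point law describes one site at a time, so sites are separated first and joined by
   [cross4Dl]. *)
have -> : A = \sum_a single_row a (row a A).
  apply/matrixP => i j; rewrite summxE (bigD1 i)//= big1 => [|a ai].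
    by rewrite !mxE eqxx addr0.
  by rewrite !mxE eq_sym (negbTE ai).
apply: (big_ind (fun B => null_seq (b B))) => //.
have -> : b 0 = fun=> 0; last exact: null_seq0.
apply/funext => k; rewrite /b /cross4 emb0 symexp0// (sub0r v) (symexpN (ID k)) !add0r.
by field.
Qed.

Let cross2_additive A B : null_seq (fun k => c (A + B) k - c A k - c B k).
Proof.
apply: null_seq_le => eps eps0.
pose M := psi A + psi B + 1.
have M0 : 0 < M by rewrite ltr_pwDr// addr_ge0.
pose eta := eps / M.
have eta0 : 0 < eta by rewrite divr_gt0.
exists (fun k => (2 * eta)^-1 * (b A k + b B k)).
  by apply: null_seqZ; exact: null_seqD.
move=> k; rewrite /c embD.
apply: (le_trans (cross2Dl (ID k) _ _ v eta0)); rewrite !psiE.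
apply: lerD; last exact: ler_norm.
rewrite /eta -subr_ge0 [X in 0 <= X](_ : _ = eps / M).
  by rewrite divr_ge0// ltW.
by rewrite /M; field; rewrite gt_eqF.
Qed.

Let cross2D A B : null_seq (c A) -> null_seq (c B) -> null_seq (c (A + B)).
Proof.
move=> A0 B0; have := null_seqD (null_seqD A0 B0) (cross2_additive A B).
by congr null_seq; apply/funext => k; ring.
Qed.

Let cross2_0 : null_seq (c 0).
Proof.
have -> : c 0 = fun=> 0; last exact: null_seq0.
by apply/funext => k; rewrite /c /cross2 emb0 symexp0// add0r add0r subrr.
Qed.

Let cross2N A : null_seq (c A) -> null_seq (c (- A)).
Proof.
move=> A0; have := null_seqB (null_seqB cross2_0 A0) (cross2_additive A (- A)).
by rewrite subrr; congr null_seq; apply/funext => k; ring.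
Qed.

Let cross2_muln A n : null_seq (c A) -> null_seq (c (A *+ n)).
Proof.
by move=> A0; elim: n => [|n IH]; rewrite ?mulr0n// mulrS; exact: cross2D.
Qed.

Let cross2_divn A n : null_seq (c A) -> null_seq (c (n.+1%:R^-1 *: A)).
Proof.
move=> A0; set B := _ *: A.
have h k : null_seq (fun i => c (B *+ k) i - k%:R * c B i).
  elim: k => [|k IH].
    by rewrite mulr0n; under eq_fun do rewrite mul0r subr0.
  rewrite mulrS; have := null_seqD IH (cross2_additive B (B *+ k)).
  by congr null_seq; apply/funext => i; rewrite -addn1 natrD; ring.
have AB : B *+ n.+1 = A.
  by rewrite -scaler_nat scalerA divff ?scale1r.
have := null_seqZ (n.+1%:R^-1) (null_seqB A0 (h n.+1)); rewrite AB.
congr null_seq; apply/funext => i.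
by field; rewrite gt_eqF// ltr0n.
Qed.

(** As for Cauchy's functional equation, additivity covers rational factors. The remainder
    [del n *: A] has a small exponent that does not depend on the sequence index, so [cross2_le]
    bounds its contribution uniformly. *)
Let cross2_scale_ge0 A r : 0 <= r -> null_seq (c A) -> null_seq (c (r *: A)).
Proof.
move=> r0 A0; apply: null_seq_le => eps eps0.
pose eta := eps / (2 * (V + 1)).
have V1 : 0 < V + 1 by rewrite ltr_pwDr.
have eta0 : 0 < eta by rewrite divr_gt0// mulr_gt0.
pose q n : nat := Num.truncn (r * n.+1%:R).
pose del n : R := r - (q n)%:R / n.+1%:R.
have del_itv n : 0 <= del n <= n.+1%:R^-1.
  have n0 : 0 < n.+1%:R :> R by [].
  have rn : 0 <= r * n.+1%:R by rewrite mulr_ge0.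
  have /andP[h1 h2] := truncn_itv rn.
  rewrite /del subr_ge0 ler_pdivrMr// h1/= lerBlDr -[X in X + _]mul1r -mulrDl.
  by rewrite ler_pdivlMr// addrC natr1 ltW.
have del0 : del @ \oo --> (0 : R).
  apply: (squeeze_cvgr (f := fun=> 0) (h := fun n => n.+1%:R^-1)).
  - exact: nearW.
  - exact: cvg_cst.
  - exact: cvg_harmonic.
have [n nP] : exists n, psi (del n *: A) <= eta * eps / 2.
  have e0 : 0 < eta * eps / 2 by rewrite divr_gt0// mulr_gt0.
  have /cvgr_le/(_ _ e0)[n _ nP] := cvg_symexp0 (emb A) (ID 0) del0.
  by exists n; rewrite -(psiE 0) embZ; exact: (nP n (leqnn n)).
pose B := (n.+1%:R^-1 *: A) *+ q n.
have rA : r *: A = B + del n *: A.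
  by rewrite /B -scaler_nat scalerA -scalerDl /del; congr (_ *: _); ring.
exists (fun k => (c (r *: A) k - c B k - c (del n *: A) k) + c B k).
  apply: null_seqD; first by rewrite rA; exact: cross2_additive.
  by apply: cross2_muln; exact: cross2_divn.
move=> k; set X := _ + c B k.
have -> : c (r *: A) k = c (del n *: A) k + X by rewrite /X; ring.
apply: (le_trans (ler_normD _ _)); rewrite lerD2r.
apply: (le_trans (cross2_le (ID k) _ v eta0)); rewrite psiE psiV.
have h1 : eta^-1 * psi (del n *: A) <= eps / 2.
  apply: (@le_trans _ _ (eta^-1 * (eta * eps / 2))).
    by rewrite ler_pM2l ?invr_gt0.
  rewrite -subr_ge0 [Y in 0 <= Y](_ : _ = 0)//.
  by field; rewrite gt_eqF.
have h2 : eta * V <= eps / 2.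
  rewrite /eta -subr_ge0 [Y in 0 <= Y](_ : _ = eps / 2 / (V + 1)).
    by rewrite !divr_ge0// ltW.
  by field; rewrite gt_eqF.
lra.
Qed.

Lemma cross24_null A : null_seq (fun k => cross2 (phi k) (emb A) v) /\
  null_seq (fun k => cross4 (phi k) (emb A) v).
Proof.
split; last exact: cross4_null.
rewrite -/(c A) [A]matrix_sum_delta.
apply: (big_ind (fun B => null_seq (c B))) => // i _.
apply: (big_ind (fun B => null_seq (c B))) => // j _.
have cd : null_seq (c (delta_mx i j)) by exact: cross2_delta.
have [r0|r0] := leP 0 (A i j); first exact: cross2_scale_ge0.
rewrite -[A i j]opprK scaleNr; apply: cross2N.
by apply: cross2_scale_ge0 => //; rewrite oppr_ge0 ltW.
Qed.

End asymptotic_independence.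

(** * Weak convergence at infinity *)

Section bessel.
Context (R : realType) d (Omega : measurableType d) (P : probability Omega R).
Context (V : normedModType R).
Variables (f g : V -> Omega -> R) (C : R).
Hypothesis bf : forall t, bounded_measurable (f t).
Hypothesis bg : forall t, bounded_measurable (g t).
Hypothesis fgC : forall t, \int[P]_w (f t w * f t w + g t w * g t w) <= C.
Hypothesis fg0 : forall t0 delta, 0 < delta -> exists M, forall t, M <= `|t| ->
  `|\int[P]_w (f t w * f t0 w + g t w * g t0 w)| <= delta.

(* Bessel's inequality: if [E (f t Y)] did not vanish at infinity, a sum of N
   far apart translates would have squared norm O(N) + o(N^2) but scalar product
   at least N eps with Y. *)
Lemma bessel_weak_limit (Y : Omega -> R) eps : bounded_measurable Y ->
  (forall w, `|Y w| <= 1) -> 0 < eps ->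
  exists M, forall t, M <= `|t| -> `|\int[P]_w (f t w * Y w)| <= eps.
Proof.
move=> bY Y1 eps0; apply: contrapT => /forallNP noM.
have far M : exists2 t, M <= `|t| & eps < `|\int[P]_w (f t w * Y w)|.
  have /existsNP[t /not_implyP[Mt /negP]] := noM M.
  by rewrite -ltNge => ?; exists t.
(* Cauchy-Schwarz will give (N eps)^2 <= N^2 delta + N C, which with this delta fails as soon as N
   exceeds 2 C / eps^2. *)
pose delta := eps ^+ 2 / 2.
have delta0 : 0 < delta by rewrite divr_gt0// exprn_gt0.
(* S + iG is a sum of N translates of f + ig, signed so that each has a positive scalar product with
   Y. The last clause keeps the next translate almost orthogonal to the sum. *)
have inv (N : nat) : exists S G : Omega -> R,
    [/\ bounded_measurable S, bounded_measurable G,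
        N%:R * eps <= \int[P]_w (S w * Y w),
        \int[P]_w (S w * S w + G w * G w) <= N%:R ^+ 2 * delta + N%:R * C &
        exists M, forall t, M <= `|t| ->
          `|\int[P]_w (f t w * S w + g t w * G w)| <= N%:R * delta].
  elim: N => [|N [S [G [bS bG SY SG [M MSG]]]]].
    exists (fun=> 0), (fun=> 0); split; [exact: bmC|exact: bmC| | |].
    - by rewrite mul0r; under eq_Rintegral do rewrite mul0r; rewrite ERC.
    - under eq_Rintegral do rewrite mul0r addr0.
      by rewrite ERC expr0n !mul0r addr0.
    - exists 0 => t _; under eq_Rintegral do rewrite !mulr0 addr0.
      by rewrite ERC normr0 mul0r.
  have [t0 Mt0 et0] := far M.
  pose a := Num.sg (\int[P]_w (f t0 w * Y w)).
  have a1 : `|a| <= 1 by rewrite normr_sg; case: (_ == _).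
  have a2 : a ^+ 2 <= 1 by rewrite -real_normK ?num_real// exprn_ile1.
  have baf : bounded_measurable (fun w => a * f t0 w).
    by apply: bmM => //; exact: bmC.
  have bag : bounded_measurable (fun w => a * g t0 w).
    by apply: bmM => //; exact: bmC.
  exists (fun w => S w + a * f t0 w), (fun w => G w + a * g t0 w).
  have bff : bounded_measurable (fun w => f t0 w * f t0 w + g t0 w * g t0 w).
    by apply: bmD; apply: bmM.
  have bfS t : bounded_measurable (fun w => f t w * S w + g t w * G w).
    by apply: bmD; apply: bmM.
  have bSS : bounded_measurable (fun w => S w * S w + G w * G w).
    by apply: bmD; apply: bmM.
  have bfY : bounded_measurable (fun w => f t0 w * Y w) by exact: bmM.
  split; [exact: bmD|exact: bmD| | |].
  - under eq_Rintegral do rewrite mulrDl -mulrA.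
    rewrite ERD ?ERZ//; [|exact: bmM|by apply: bmM => //; exact: bmC].
    rewrite -addn1 natrD mulrDl mul1r lerD// /a -normrEsg.
    exact: ltW.
  - have -> : \int[P]_w ((S w + a * f t0 w) * (S w + a * f t0 w) +
        (G w + a * g t0 w) * (G w + a * g t0 w)) =
        \int[P]_w (S w * S w + G w * G w) +
        (2 * a * \int[P]_w (f t0 w * S w + g t0 w * G w) +
         a ^+ 2 * \int[P]_w (f t0 w * f t0 w + g t0 w * g t0 w)).
      rewrite -!ERZ// -!ERD//.
      - by apply: eq_Rintegral => w _; ring.
      - by apply: bmD; apply: bmM => //; exact: bmC.
      - by apply: bmM => //; exact: bmC.
      - by apply: bmM => //; exact: bmC.
    have ff0 : 0 <= \int[P]_w (f t0 w * f t0 w + g t0 w * g t0 w).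
      by apply: Rintegral_ge0 => w _; rewrite addr_ge0// -expr2 sqr_ge0.
    have h1 : a ^+ 2 * \int[P]_w (f t0 w * f t0 w + g t0 w * g t0 w) <= C.
      by rewrite (le_trans _ (fgC t0))// ler_piMl.
    have h2 : a * \int[P]_w (f t0 w * S w + g t0 w * G w) <= N%:R * delta.
      rewrite (le_trans (ler_norm _))// normrM.
      by rewrite (le_trans _ (MSG _ Mt0))// ler_piMl.
    have -> : N.+1%:R ^+ 2 * delta + N.+1%:R * C =
        N%:R ^+ 2 * delta + N%:R * C + (2 * (N%:R * delta) + C) + delta.
      by rewrite -natr1; ring.
    rewrite -[X in X <= _]addr0 lerD ?(ltW delta0)// lerD// lerD//.
    by rewrite -mulrA ler_pM2l.
  - have [M' M't] := fg0 t0 delta0.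
    exists (Num.max M M') => t; rewrite ge_max => /andP[Mt M't'].
    have -> : \int[P]_w (f t w * (S w + a * f t0 w) + g t w * (G w + a * g t0 w)) =
        \int[P]_w (f t w * S w + g t w * G w) +
        a * \int[P]_w (f t w * f t0 w + g t w * g t0 w).
      have bftt : bounded_measurable (fun w => f t w * f t0 w + g t w * g t0 w).
        by apply: bmD; apply: bmM.
      rewrite -ERZ// -ERD//; last by apply: bmM => //; exact: bmC.
      by apply: eq_Rintegral => w _; ring.
    apply: (le_trans (ler_normD _ _)); rewrite -addn1 natrD mulrDl mul1r.
    rewrite lerD ?MSG// normrM (le_trans _ (M't _ M't'))//.
    by rewrite ler_piMl.
pose N := (Num.truncn (2 * C / eps ^+ 2)).+1.
have e2 : 0 < eps ^+ 2 by rewrite exprn_gt0.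
have C0 : 0 <= C.
  apply: le_trans (fgC 0); apply: Rintegral_ge0 => w _.
  by rewrite addr_ge0// -expr2 sqr_ge0.
have NC : 2 * C < N%:R * eps ^+ 2.
  by rewrite -ltr_pdivrMr// /N truncnS_gt.
have N0 : 0 < N%:R :> R by rewrite ltr0n.
have [S [G [bS bG SY SG _]]] := inv N.
(* Cauchy-Schwarz is used as u <= lam / 2 u^2 + 1 / (2 lam), with 1 / lam the lower bound of the
   scalar product. *)
pose lam := (N%:R * eps)^-1.
have lam0 : 0 < lam by rewrite invr_gt0 mulr_gt0.
have bSS : bounded_measurable (fun w => S w * S w + G w * G w).
  by apply: bmD; apply: bmM.
have : \int[P]_w (S w * Y w) <=
    \int[P]_w (lam / 2 * (S w * S w + G w * G w) + (2 * lam)^-1).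
  apply: ER_le; [exact: bmM| |].
    by apply: bmD; [apply: bmM => //|]; exact: bmC.
  move=> w; apply: (@le_trans _ _ `|S w|).
    by rewrite (le_trans (ler_norm _))// normrM ler_piMr.
  apply: (@le_trans _ _ (lam / 2 * (S w * S w) + (2 * lam)^-1)).
    rewrite -expr2 -real_normK ?num_real//; move: `|S w| => u.
    rewrite -subr_ge0 [X in 0 <= X](_ : _ = lam / 2 * (u - lam^-1) ^+ 2).
      by rewrite mulr_ge0 ?sqr_ge0// divr_ge0// ltW.
    by field; rewrite gt_eqF.
  rewrite lerD2r ler_pM2l ?divr_gt0// lerDl -expr2 sqr_ge0//.
rewrite ERD ?ERC ?ERZ//; [|by apply: bmM => //; exact: bmC|exact: bmC].
have h3 : lam / 2 * \int[P]_w (S w * S w + G w * G w) <=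
    lam / 2 * (N%:R ^+ 2 * delta + N%:R * C) by rewrite ler_pM2l ?divr_gt0.
move=> h4; have := le_trans SY (le_trans h4 (lerD h3 (lexx _))).
apply/negP; rewrite -ltNge /lam /delta -subr_gt0.
rewrite [X in 0 < X](_ : _ = (N%:R * eps ^+ 2 - 2 * C) / (4 * eps)).
  by rewrite divr_gt0 ?subr_gt0// mulr_gt0.
by field; rewrite !gt_eqF.
Qed.

End bessel.

(** * Random fields *)

Section stacked_vectors.
Context (R : realType) (disp : measure_display) (Omega : measurableType disp).
Context (P : probability Omega R) (l d : nat).
Variable X : 'rV[R]_l -> {RV P >-> 'rV[R]_d}.

Lemma dotv_mxvec m n (A : 'M[R]_(m, n)) (x : 'rV[R]_(m * n)) :
  dotv (mxvec A) x = \sum_a \sum_j A a j * vec_mx x a j.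
Proof.
rewrite pair_bigA /dotv.
rewrite (reindex _ (curry_mxvec_bij m n)) /=.
by apply: eq_bigr => -[a j] _ /=; rewrite mxvecE -(mxvecE (vec_mx x)) vec_mxK.
Qed.

Lemma dotv_stack m (A : 'M[R]_(m, d)) (s : 'I_m -> 'rV[R]_l) w :
  dotv (mxvec A) (stack X s w) = \sum_a dotv (row a A) (X (s a) w).
Proof.
rewrite dotv_mxvec /stack mxvecK; apply: eq_bigr => a _.
by apply: eq_bigr => j _; rewrite !mxE.
Qed.

Lemma measurable_stack m (s : 'I_m -> 'rV[R]_l) :
  measurable_fun [set: Omega] (stack X s).
Proof.
apply: measurable_fun_rV => k; case/mxvec_indexP: k => a j.
under eq_fun do rewrite /stack mxvecE mxE.
exact: (measurableT_comp (measurable_coord j) (measurable_funP (X (s a)))).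
Qed.

Lemma measurable_component t (j : 'I_d) :
  measurable_fun [set: Omega] (fun w => X t w ord0 j).
Proof. exact: (measurableT_comp (measurable_coord j) (measurable_funP (X t))). Qed.

Definition cis_mean (f : Omega -> R) : R[i] :=
  cintegral P (fun w => cexp ('i * (f w)%:C)).

Lemma cis_meanE f : cis_mean f = (\int[P]_w cos (f w)) +i* (\int[P]_w sin (f w)).
Proof.
by rewrite /cis_mean /cintegral; congr (_ +i* _); apply: eq_Rintegral => w _;
  rewrite cexp_i.
Qed.

Lemma charfun_cis_mean n (f : Omega -> 'rV[R]_n) (nu : probability 'rV[R]_n R) theta :
  measurable_fun [set: Omega] f ->
  (forall B, measurable B -> nu B = pushforward P f B) ->
  charfun nu theta = cis_mean (fun w => dotv theta (f w)).
Proof.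
move=> mf nuE; rewrite charfunE cis_meanE.
by congr (_ +i* _); rewrite (ER_pushforward mf nuE)//;
  [exact: bm_cos_dotv|exact: bm_sin_dotv].
Qed.

Lemma fdd_id_charfun m (s : 'I_m -> 'rV[R]_l) : infinitely_divisible_field X ->
  id_charfun (fun theta => cis_mean (fun w => dotv theta (stack X s w))).
Proof.
move=> XID k; have [rho [nu [nuE nuC]]] := infinitely_divisible_charfun (XID m s) k.
exists rho => theta; rewrite -nuC (charfun_cis_mean _ (measurable_stack s))//.
by move=> B mB; rewrite -nuE.
Qed.

Lemma stationary_mean m (s : 'I_m -> 'rV[R]_l) (h : 'rV[R]_l)
    (g : 'rV[R]_(m * d) -> R) :
  strictly_stationary X -> bounded_measurable g ->
  \int[P]_w g (stack X (fun a => s a + h) w) = \int[P]_w g (stack X s w).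
Proof.
move=> Xstat bg.
pose F t : {mfun Omega >-> 'rV[R]_(m * d)} := MeasurableFun.Pack
  (MeasurableFun.Class (isMeasurableFun.Build _ _ _ _ _ (@measurable_stack m t))).
rewrite -(ER_pushforward (Q := distribution P (F s)) (measurable_stack s))//.
rewrite -(ER_pushforward (Q := distribution P (F s))
  (measurable_stack (fun a => s a + h)))// => B mB.
exact/esym/(Xstat m s h B mB).
Qed.

Lemma stationary_cis_mean m (A : 'M[R]_(m, d)) (s : 'I_m -> 'rV[R]_l) h :
  strictly_stationary X ->
  cis_mean (fun w => \sum_a dotv (row a A) (X (s a + h) w)) =
  cis_mean (fun w => \sum_a dotv (row a A) (X (s a) w)).
Proof.
move=> Xstat; rewrite !cis_meanE; congr (_ +i* _).
- under eq_Rintegral do rewrite -(dotv_stack _ (fun a => s a + h)).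
  under [RHS]eq_Rintegral do rewrite -dotv_stack.
  exact: (stationary_mean _ _ Xstat (bm_cos_dotv _)).
- under eq_Rintegral do rewrite -(dotv_stack _ (fun a => s a + h)).
  under [RHS]eq_Rintegral do rewrite -dotv_stack.
  exact: (stationary_mean _ _ Xstat (bm_sin_dotv _)).
Qed.

Lemma stationary_cis_mean1 theta t : strictly_stationary X ->
  cis_mean (fun w => dotv theta (X t w)) = cis_mean (fun w => dotv theta (X 0 w)).
Proof.
move=> Xstat; have := @stationary_cis_mean 1 theta (fun=> 0) t Xstat.
have rE (a : 'I_1) : row a theta = theta.
  by apply/rowP => j; rewrite mxE; congr (theta _ _); apply/val_inj; case: a => -[].
under [X in cis_mean X = _]eq_fun do rewrite big_ord1 add0r rE.
by under [X in _ = cis_mean X]eq_fun do rewrite big_ord1 rE.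
Qed.

Lemma cis_mean_distribution t theta :
  charfun (distribution P (X t)) theta = cis_mean (fun w => dotv theta (X t w)).
Proof. by apply: charfun_cis_mean => //; exact: measurable_funP. Qed.

End stacked_vectors.

Lemma ccvgP (R : realType) (u : nat -> R[i]) (z : R[i]) :
  ccvg u z <-> null_seq (fun k => Normc.normc (u k - z)).
Proof.
have nE (w : R[i]) : `|w| = (Normc.normc w)%:C by case: w.
split=> [/cvgrPdist_le uz|/cvgr0Pnorm_le uz].
- apply/cvgr0Pnorm_le => eps eps0.
  have e0 : 0 < eps%:C :> R[i] by rewrite ltcR.
  near=> k; rewrite ger0_norm ?normc_ge0//.
  have : `|z - u k| <= eps%:C by near: k; exact: uz.
  by rewrite distrC nE lecR.
- apply/cvgrPdist_le => eps eps0.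
  have epsE : eps = (complex.Re eps)%:C.
    by case: eps eps0 => a b; rewrite ltcE/= => /andP[/eqP -> _].
  have e0 : 0 < complex.Re eps by move: eps0; rewrite {1}epsE ltcR.
  near=> k; have : `|Normc.normc (u k - z)| <= complex.Re eps.
    by near: k; exact: uz.
  rewrite ger0_norm ?normc_ge0// -lecR -nE -epsE distrC.
  exact.
Unshelve. all: by end_near. Qed.

Section component_limit.
Context (R : realType) (disp : measure_display) (Omega : measurableType disp).
Context (P : probability Omega R) (l d : nat).
Variable X : 'rV[R]_l -> {RV P >-> 'rV[R]_d}.
Hypothesis Xstat : strictly_stationary X.
Variable j : 'I_d.

Let x t w : R := X t w ord0 j.
Let c1 := \int[P]_w cos (x 0 w).
Let c2 := \int[P]_w sin (x 0 w).

Hypothesis corr : forall t, escaping t ->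
  null_seq (fun k => \int[P]_w cos (x (t k) w - x 0 w) - (c1 ^+ 2 + c2 ^+ 2)).

Let xE t w : x t w = dotv (delta_mx ord0 j) (X t w).
Proof. by rewrite dotv_delta. Qed.

Let mx t : measurable_fun [set: Omega] (x t).
Proof. exact: measurable_component. Qed.

Let Ecos t : \int[P]_w cos (x t w) = c1.
Proof.
have := stationary_cis_mean1 (delta_mx ord0 j) t Xstat.
rewrite !cis_meanE => -[h _]; move: h; rewrite /c1.
by under eq_Rintegral do rewrite -xE; under [RHS]eq_Rintegral do rewrite -xE.
Qed.

Let Esin t : \int[P]_w sin (x t w) = c2.
Proof.
have := stationary_cis_mean1 (delta_mx ord0 j) t Xstat.
rewrite !cis_meanE => -[_ h]; move: h; rewrite /c2.
by under eq_Rintegral do rewrite -xE; under [RHS]eq_Rintegral do rewrite -xE.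
Qed.

Let Ecos_sub t s : \int[P]_w cos (x t w - x s w) = \int[P]_w cos (x (t - s) w - x 0 w).
Proof.
pose A : 'M[R]_(1 + 1, d) := col_mx (delta_mx ord0 j : 'rV_d) (- delta_mx ord0 j : 'rV_d).
pose p (a : 'I_(1 + 1)) := if a == lshift 1 ord0 then t - s else 0.
have := @stationary_cis_mean _ _ _ P _ _ X _ A p s Xstat.
have E h w : \sum_a dotv (row a A) (X (p a + h) w) = x (t - s + h) w - x (0 + h) w.
  rewrite /A (@big_split_ord _ _ _ 1 1)/= !big_ord1 rowKu rowKd !row_id.
  by rewrite dotvNl -!xE.
under [X in cis_mean _ X = _]eq_fun do rewrite E subrK add0r.
under [X in _ = cis_mean _ X]eq_fun => w.
  under eq_bigr do rewrite -[p _]addr0.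
  rewrite E !addr0; over.
by rewrite !cis_meanE => -[].
Qed.

(** [bessel_weak_limit] needs a bound outside a ball rather than along sequences: counterexamples of
    norm at least k, one for each k, would form an escaping sequence. *)
Let corr_far delta : 0 < delta -> exists M, forall t, M <= `|t| ->
  `|\int[P]_w cos (x t w - x 0 w) - (c1 ^+ 2 + c2 ^+ 2)| <= delta.
Proof.
move=> delta0; apply: contrapT => /forallNP noM.
have /choice[t tP] : forall k : nat, exists t : 'rV[R]_l, k%:R <= `|t| /\
    delta < `|\int[P]_w cos (x t w - x 0 w) - (c1 ^+ 2 + c2 ^+ 2)|.
  move=> k; have /existsNP[t /not_implyP[Mt /negP]] := noM k%:R.
  by rewrite -ltNge => ?; exists t.
have esc : escaping t.
  apply/cvgryPge => A; near=> k; apply: le_trans (tP k).1.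
  by near: k; exact: nbhs_infty_ger.
have /cvgr0Pnorm_le/(_ _ delta0)[k _ kP] := corr esc.
by have := kP k (leqnn k); rewrite /= leNgt (tP k).2.
Unshelve. all: by end_near. Qed.

(** With c = c1 + i c2, the real part of (e^{i x_t} - c) times the conjugate of e^{i x_s} - c is
    symmetric in cosine and sine, so one argument treats both. Its mean depends only on t - s. *)
Let weak (f g : R -> R) (a b : R) (Y : Omega -> R) eps :
  (f = cos /\ g = sin /\ a = c1 /\ b = c2) \/ (f = sin /\ g = cos /\ a = c2 /\ b = c1) ->
  bounded_measurable Y -> (forall w, `|Y w| <= 1) -> 0 < eps ->
  exists M, forall t, M <= `|t| ->
    `|\int[P]_w (f (x t w) * Y w) - a * \int[P]_w Y w| <= eps.
Proof.
move=> fg bY Y1 eps0.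
have bcos t : bounded_measurable (fun w => cos (x t w)) by exact: bm_cos.
have bsin t : bounded_measurable (fun w => sin (x t w)) by exact: bm_sin.
have bcosB t s : bounded_measurable (fun w => cos (x t w - x s w)).
  by apply: bm_cos; exact: measurable_funB.
have bf t : bounded_measurable (fun w => f (x t w)) by case: fg => [][->].
have bg t : bounded_measurable (fun w => g (x t w)) by case: fg => [][_][->].
have bfa t : bounded_measurable (fun w => f (x t w) - a).
  by apply: bmB => //; exact: bmC.
have bgb t : bounded_measurable (fun w => g (x t w) - b).
  by apply: bmB => //; exact: bmC.
have corrE t s : \int[P]_w ((f (x t w) - a) * (f (x s w) - a) +
      (g (x t w) - b) * (g (x s w) - b)) =
    \int[P]_w cos (x (t - s) w - x 0 w) - (c1 ^+ 2 + c2 ^+ 2).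
  transitivity (\int[P]_w (cos (x t w - x s w) +
      (- c1 * (cos (x t w) + cos (x s w)) - c2 * (sin (x t w) + sin (x s w))) +
      (c1 ^+ 2 + c2 ^+ 2))).
    by apply: eq_Rintegral => w _; rewrite cosB; case: fg => [][->][->][->]->; ring.
  have b1 : bounded_measurable (fun w => - c1 * (cos (x t w) + cos (x s w))).
    by apply: bmM; [exact: bmC|exact: bmD].
  have b2 : bounded_measurable (fun w => c2 * (sin (x t w) + sin (x s w))).
    by apply: bmM; [exact: bmC|exact: bmD].
  rewrite (ERD _ (bmD (bcosB t s) (bmB b1 b2)) (bmC _ _)) ERC.
  rewrite (ERD _ (bcosB t s) (bmB b1 b2)) (ERB _ b1 b2).
  rewrite (ERZ _ _ (bmD (bcos t) (bcos s))) (ERZ _ _ (bmD (bsin t) (bsin s))).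
  rewrite (ERD _ (bcos t) (bcos s)) (ERD _ (bsin t) (bsin s)).
  by rewrite !Ecos !Esin Ecos_sub; ring.
have [M MP] : exists M, forall t, M <= `|t| ->
    `|\int[P]_w ((f (x t w) - a) * Y w)| <= eps.
  apply: (@bessel_weak_limit R _ Omega P _
    (fun t w => f (x t w) - a) (fun t w => g (x t w) - b)
    (\int[P]_w cos (x 0 w - x 0 w) - (c1 ^+ 2 + c2 ^+ 2))) => //.
    by move=> t; rewrite corrE subrr.
  move=> t0 delta /corr_far[M MP]; exists (M + `|t0|) => t tM.
  rewrite corrE; apply: MP.
  by rewrite (le_trans _ (lerB_dist _ _))// lerBrDr.
exists M => t /MP.
have -> // : \int[P]_w ((f (x t w) - a) * Y w) =
    \int[P]_w (f (x t w) * Y w) - a * \int[P]_w Y w.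
rewrite -ERZ// -ERB//; last 2 first.
- exact: bmM.
- by apply: bmM => //; exact: bmC.
by apply: eq_Rintegral => w _; rewrite mulrBl.
Qed.

Lemma component_weak_limit (Y : Omega -> R) t : bounded_measurable Y ->
  (forall w, `|Y w| <= 1) -> escaping t ->
  null_seq (fun k => \int[P]_w (cos (x (t k) w) * Y w) - c1 * \int[P]_w Y w) /\
  null_seq (fun k => \int[P]_w (sin (x (t k) w) * Y w) - c2 * \int[P]_w Y w).
Proof.
move=> bY Y1 esc; split; apply/cvgr0Pnorm_le => eps eps0.
- have [|M MP] := @weak cos sin c1 c2 Y eps _ bY Y1 eps0; first by left.
  near=> k; apply: MP; near: k.
  by have /cvgryPge := esc; exact.
- have [|M MP] := @weak sin cos c2 c1 Y eps _ bY Y1 eps0; first by right.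
  near=> k; apply: MP; near: k.
  by have /cvgryPge := esc; exact.
Unshelve. all: by end_near. Qed.

End component_limit.

Lemma cvg_ln_sqmodM (R : realType) (f : nat -> R[i]) (z w : R[i]) :
  0 < sqmod z -> 0 < sqmod w ->
  sqmod (f k) @[k --> \oo] --> sqmod (z * w) ->
  - ln (sqmod (f k)) @[k --> \oo] --> - ln (sqmod z) - ln (sqmod w).
Proof.
move=> z0 w0 fzw; rewrite -opprD -lnM ?posrE// -sqmodM; apply: cvgN.
by apply: continuous_cvg fzw; apply: continuous_ln; rewrite sqmodM mulr_gt0.
Qed.

(** [cross4] involves both u + v and u - v. The exponent of -v enters separately as V', to be
    identified with V by evenness. *)
Lemma cross_null (R : realType) n (phi : nat -> 'rV[R]_n -> R[i]) u v U V V' :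
  (forall k, symexp (phi k) u = U) -> (forall k, symexp (phi k) v = V) ->
  symexp (phi k) (u + v) @[k --> \oo] --> U + V ->
  V' = V -> symexp (phi k) (u - v) @[k --> \oo] --> U + V' ->
  null_seq (fun k => cross2 (phi k) u v) /\
  null_seq (fun k => cross4 (phi k) u v).
Proof.
move=> hu hv h1 -> h2; rewrite /null_seq; split.
  under eq_fun do rewrite /cross2 hu hv.
  by rewrite -(subrr (U + V)); apply: cvgB; [exact: cvg_cst|exact: h1].
under eq_fun do rewrite /cross4 hu hv.
have <- : (U + V) - 2^-1 * ((U + V) + (U + V)) = 0 by field.
apply: cvgB; first exact: cvg_cst.
by apply: cvgM; [exact: cvg_cst|exact: cvgD].
Qed.

(** [cross2] corrects the modulus, through a factor exp (cross2 / 2) that tends to 1, and [cross4]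
    bounds the phase by [id_charfun_phase]. *)
Lemma null_cross_phase (R : realType) n (phi : nat -> 'rV[R]_n -> R[i]) u v a b :
  (forall k, id_charfun (phi k)) ->
  (forall k, phi k u = a) -> (forall k, phi k v = b) ->
  null_seq (fun k => cross2 (phi k) u v) ->
  null_seq (fun k => cross4 (phi k) u v) ->
  null_seq (fun k => Normc.normc (phi k (u + v) - b * a)).
Proof.
move=> ID phiu phiv c0 b0.
have normc_le1 w : Normc.normc (phi 0 w) <= 1.
  have [rho ->] := id_charfunW (ID 0).
  by rewrite normc_sqrt -sqrtr1 ler_sqrt// sqmod_charfun_le1.
pose U : R := - ln (sqmod a); pose V : R := - ln (sqmod b).
have U0 : 0 <= U by have := symexp_ge0 u (ID 0); rewrite /symexp phiu.
have V0 : 0 <= V by have := symexp_ge0 v (ID 0); rewrite /symexp phiv.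
have na : Normc.normc a <= 1 by rewrite -(phiu 0).
have nb : Normc.normc b <= 1 by rewrite -(phiv 0).
apply: null_seq_le => eps eps0.
pose eta := eps / (U + V + 1).
have UV1 : 0 < U + V + 1 by rewrite ltr_pwDr// addr_ge0.
have eta0 : 0 < eta by rewrite divr_gt0.
exists (fun k => 2 / eta * cross4 (phi k) u v +
    `|expR (cross2 (phi k) u v / 2) - 1|).
  apply: null_seqD; first exact: null_seqZ.
  rewrite /null_seq -(normr0 R) -(subrr (1 : R)); apply: cvg_norm.
  apply: cvgB; last exact: cvg_cst.
  have c2 : cross2 (phi k) u v / 2 @[k --> \oo] --> (0 : R).
    by rewrite -(mul0r 2^-1); apply: cvgM; [exact: c0|exact: cvg_cst].
  have : expR (cross2 (phi k) u v / 2) @[k --> \oo] --> expR 0.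
    by apply: continuous_cvg c2; exact: continuous_expR.
  by rewrite expR0.
move=> k; rewrite ger0_norm ?normc_ge0//.
have := id_charfun_phase u v (ID k) eta0.
rewrite /symexp phiu phiv -/U -/V; set e := expR _ => h.
have -> : phi k (u + v) - b * a =
  (phi k (u + v) - e%:C * (a * b)) + (e - 1)%:C * (a * b).
  by rewrite rmorphB/= mulrBl mul1r addrA subrK (mulrC b).
apply: (le_trans (le_normcD _ _)).
apply: (le_trans (lerD h (lexx _))).
have he : Normc.normc ((e - 1)%:C * (a * b)) <= `|e - 1|.
  rewrite !Normc.normcM.
  have -> : Normc.normc (e - 1)%:C = `|e - 1| by rewrite /= expr0n addr0 sqrtr_sqr.
  by rewrite ler_piMr// -[1]mulr1 ler_pM ?normc_ge0.
apply: (le_trans (lerD (lexx _) he)).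
rewrite -addrA; apply: lerD; last exact: ler_norm.
rewrite /eta -subr_ge0 [Y in 0 <= Y](_ : _ = eps / 2 * ((U + V + 1 + 1) / (U + V + 1))).
  apply: mulr_ge0; first by rewrite divr_ge0// ltW.
  by apply: divr_ge0; rewrite ?addr_ge0// ltW.
by field; rewrite gt_eqF.
Qed.

(** * The joint law at fixed and moving times *)

Section mixing_of_components.
Context (R : realType) (disp : measure_display) (Omega : measurableType disp).
Context (P : probability Omega R) (l d : nat).
Variable X : 'rV[R]_l -> {RV P >-> 'rV[R]_d}.
Hypothesis Xstat : strictly_stationary X.
Hypothesis XID : infinitely_divisible_field X.
Variable Q0 : {measure set 'rV[R]_d -> \bar R}.
Hypothesis Q0levy : is_levy_measure (distribution P (X 0)) Q0.
Variable j0 : 'I_d.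
Hypothesis Q0j0 :
  Q0 [set x : 'rV[R]_d | cos (dotv (delta_mx ord0 j0) x) = 1] = 0%E.

Let x j t w : R := X t w ord0 j.

Hypothesis corr : forall j t, escaping t ->
  null_seq (fun k => \int[P]_w cos (x j (t k) w - x j 0 w) -
    ((\int[P]_w cos (x j 0 w)) ^+ 2 + (\int[P]_w sin (x j 0 w)) ^+ 2)).

Variables (m : nat) (s p : 'I_m -> 'rV[R]_l) (t : nat -> 'rV[R]_l).
Hypothesis tesc : escaping t.

Let points k (a : 'I_(m + m)) : 'rV[R]_l :=
  match fintype.split a with inl i => s i | inr i => p i + t k end.

Let phi k (theta : 'rV[R]_((m + m) * d)) : R[i] :=
  cis_mean P (fun w => dotv theta (stack X (points k) w)).

Let left (A : 'M[R]_(m, d)) : 'rV[R]_((m + m) * d) := mxvec (col_mx A 0).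
Let right (A : 'M[R]_(m, d)) : 'rV[R]_((m + m) * d) := mxvec (col_mx 0 A).

Let dotL A w : R := \sum_a dotv (row a A) (X (s a) w).

Let dot_left A k w : dotv (left A) (stack X (points k) w) = dotL A w.
Proof.
rewrite dotv_stack big_split_ord/= [X in _ + X]big1 ?addr0 => [|a _].
  apply: eq_bigr => a _; rewrite /points.
  have -> : fintype.split (lshift m a) = inl a by exact: (unsplitK (inl a)).
  by rewrite rowKu.
rewrite -[RHS](dotv0l (X (points k (rshift m a)) w)); congr dotv.
by rewrite rowKd row0.
Qed.

Let dot_right A k w : dotv (right A) (stack X (points k) w) =
  \sum_a dotv (row a A) (X (p a + t k) w).
Proof.
rewrite dotv_stack big_split_ord/= [X in X + _]big1 ?add0r => [|a _].
  apply: eq_bigr => a _; rewrite /points.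
  have -> : fintype.split (rshift m a) = inr a by exact: (unsplitK (inr a)).
  by rewrite rowKd.
rewrite -[RHS](dotv0l (X (points k (lshift m a)) w)); congr dotv.
by rewrite rowKu row0.
Qed.

Let phiID k : id_charfun (phi k).
Proof. exact: fdd_id_charfun. Qed.

Let phi_left A k : phi k (left A) = cis_mean P (dotL A).
Proof. by rewrite /phi; under eq_fun do rewrite dot_left. Qed.

Let phi_right A k : phi k (right A) =
  cis_mean P (fun w => \sum_a dotv (row a A) (X (p a) w)).
Proof.
rewrite /phi; under eq_fun do rewrite dot_right.
exact: stationary_cis_mean.
Qed.

Let pr (a : 'I_m) (y : 'rV[R]_((m + m) * d)) : 'rV[R]_d :=
  row (rshift m a) (vec_mx y).

Let rightE a theta y : dotv (right (single_row a theta)) y = dotv theta (pr a y).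
Proof.
rewrite dotv_mxvec (bigD1 (rshift m a))//= [X in _ + X]big1 ?addr0 => [|b ba].
  by apply: eq_bigr => j _; rewrite col_mxEd [pr a y _ _]mxE mxE eqxx.
rewrite big1// => j _; move: ba; case: (splitP b) => i bi ba.
  have -> : b = lshift m i by exact: val_inj.
  by rewrite col_mxEu mxE mul0r.
have bE : b = rshift m i by exact: val_inj.
rewrite bE col_mxEd mxE; case: eqP => [ia|_]; last by rewrite mul0r.
by move: ba; rewrite bE ia eqxx.
Qed.

Let dot_single a theta (q : 'I_m -> 'rV[R]_l) w :
  \sum_b dotv (row b (single_row a theta)) (X (q b) w) = dotv theta (X (q a) w).
Proof.
rewrite (bigD1 a)//= row_single_row eqxx big1 ?addr0// => b /negbTE ba.
by rewrite row_single_row ba dotv0l.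
Qed.

Let phi_single a theta k :
  phi k (right (single_row a theta)) = charfun (distribution P (X 0)) theta.
Proof.
rewrite phi_right; under eq_fun do rewrite dot_single.
by rewrite stationary_cis_mean1// cis_mean_distribution.
Qed.

Let xE j r w : x j r w = dotv (delta_mx ord0 j) (X r w).
Proof. by rewrite dotv_delta. Qed.

Let mx j r : measurable_fun [set: Omega] (x j r).
Proof. exact: measurable_component. Qed.

Let mL A : measurable_fun [set: Omega] (dotL A).
Proof.
apply: measurable_sum => a.
exact: (measurableT_comp (measurable_dotv _) (measurable_funP (X (s a)))).
Qed.

(** The weak limit is tested against cos and sin of the fixed functional [dotL A]; the four real
    limits recombine into the product of the two characteristic functions. *)
Let symexp_cvg a j A :
  symexp (phi k) (right (delta_mx a j) + left A) @[k --> \oo] -->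
  symexp (phi 0) (right (delta_mx a j)) + symexp (phi 0) (left A).
Proof.
have U0 := id_charfun_gt0 (right (delta_mx a j)) (phiID 0).
have W0 := id_charfun_gt0 (left A) (phiID 0).
have single : single_row a (delta_mx ord0 j) = delta_mx a j :> 'M[R]_(m, d).
  exact: single_row_delta.
have phiU : phi 0 (right (delta_mx a j)) = cis_mean P (x j 0).
  rewrite -single phi_single cis_mean_distribution.
  by under eq_fun do rewrite -xE.
have phiW : phi 0 (left A) = cis_mean P (dotL A) by exact: phi_left.
have phiUW k : phi k (right (delta_mx a j) + left A) =
    cis_mean P (fun w => x j (p a + t k) w + dotL A w).
  rewrite /phi; congr cis_mean; apply/funext => w.
  rewrite dotvDl dot_left dot_right -single.
  by rewrite (dot_single a _ (fun b => p b + t k)) -xE.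
have pesc : escaping (fun k => p a + t k).
  apply/cvgryPge => B; near=> k.
  have : B + `|p a| <= `|t k| by near: k; move/cvgryPge: tesc; exact.
  rewrite -lerBrDr => /le_trans; apply.
  by rewrite (addrC (p a)) lerB_normD.
have bc j' r : bounded_measurable (fun w => cos (x j' r w)) by exact: bm_cos.
have bs j' r : bounded_measurable (fun w => sin (x j' r w)) by exact: bm_sin.
have bcL : bounded_measurable (fun w => cos (dotL A w)) by exact: bm_cos.
have bsL : bounded_measurable (fun w => sin (dotL A w)) by exact: bm_sin.
have [cc sc] := component_weak_limit Xstat (@corr j) bcL (fun w => cos_max _) pesc.
have [cs ss] := component_weak_limit Xstat (@corr j) bsL (fun w => sin_max _) pesc.
have cvg_of (f : nat -> R) (z : R) : null_seq (fun k => f k - z) -> f @ \oo --> z.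
  by move=> /subr_cvg0.
apply: (cvg_ln_sqmodM U0 W0).
have sqE k : sqmod (phi k (right (delta_mx a j) + left A)) =
    (\int[P]_w cos (x j (p a + t k) w + dotL A w)) ^+ 2 +
    (\int[P]_w sin (x j (p a + t k) w + dotL A w)) ^+ 2.
  by rewrite phiUW cis_meanE.
under eq_cvg do rewrite sqE.
have -> : sqmod (phi 0 (right (delta_mx a j)) * phi 0 (left A)) =
    ((\int[P]_w cos (x j 0 w)) * (\int[P]_w cos (dotL A w)) -
     (\int[P]_w sin (x j 0 w)) * (\int[P]_w sin (dotL A w))) ^+ 2 +
    ((\int[P]_w cos (x j 0 w)) * (\int[P]_w sin (dotL A w)) +
     (\int[P]_w sin (x j 0 w)) * (\int[P]_w cos (dotL A w))) ^+ 2.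
  by rewrite phiU phiW !cis_meanE.
have cRe : \int[P]_w cos (x j (p a + t k) w + dotL A w) @[k --> \oo] -->
    (\int[P]_w cos (x j 0 w)) * (\int[P]_w cos (dotL A w)) -
    (\int[P]_w sin (x j 0 w)) * (\int[P]_w sin (dotL A w)).
  apply: cvg_of; have := null_seqB cc ss; congr null_seq; apply/funext => k.
  under [in RHS]eq_Rintegral do rewrite cosD.
  by rewrite ERB; [ring|exact: bmM|exact: bmM].
have cIm : \int[P]_w sin (x j (p a + t k) w + dotL A w) @[k --> \oo] -->
    (\int[P]_w cos (x j 0 w)) * (\int[P]_w sin (dotL A w)) +
    (\int[P]_w sin (x j 0 w)) * (\int[P]_w cos (dotL A w)).
  apply: cvg_of; have := null_seqD cs sc; congr null_seq; apply/funext => k.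
  under [in RHS]eq_Rintegral do rewrite sinD.
  by rewrite ERD; [ring|exact: bmM|exact: bmM].
by apply: cvgD; rewrite expr2; apply: cvgM.
Unshelve. all: by end_near. Qed.

Let leftN A : - left A = left (- A).
Proof. by rewrite /left -linearN/= opp_col_mx oppr0. Qed.

Let symexp_left A k : symexp (phi k) (left A) = symexp (phi 0) (left A).
Proof. by rewrite /symexp !phi_left. Qed.

Let symexp_right A k : symexp (phi k) (right A) = symexp (phi 0) (right A).
Proof. by rewrite /symexp !phi_right. Qed.

Let cross_delta A a j :
  null_seq (fun k => cross2 (phi k) (right (delta_mx a j)) (left A)) /\
  null_seq (fun k => cross4 (phi k) (right (delta_mx a j)) (left A)).
Proof.
have eV : symexp (phi 0) (left (- A)) = symexp (phi 0) (left A).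
  exact: etrans (congr1 (symexp (phi 0)) (esym (leftN A)))
    (symexpN (phiID 0) (left A)).
apply: (cross_null (symexp_right (delta_mx a j)) (symexp_left A) _ eV).
  exact: symexp_cvg.
by rewrite leftN; exact: symexp_cvg.
Qed.

(** In [cross24_null], the moving times play the role of [emb] through [right], and the fixed
    functional is [v = left A]. Stationarity makes both exponents independent of k. *)
Let null_joint (A B : 'M[R]_(m, d)) :
  null_seq (fun k => Normc.normc (phi k (right B + left A) -
    cis_mean P (dotL A) * cis_mean P (fun w => \sum_a dotv (row a B) (X (p a) w)))).
Proof.
have rightD C D : right (C + D) = right C + right D.
  by rewrite /right -linearD/= add_col_mx addr0.
have rightZ c C : right (c *: C) = c *: right C.
  by rewrite /right -linearZ/= scale_col_mx scaler0.
have muE a theta : symexp (phi 0) (right (single_row a theta)) =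
    symexp (charfun (distribution P (X 0))) theta.
  by rewrite /symexp phi_single.
have [c0 b0] := cross24_null phiID rightD rightZ (symexp_left A)
  (fun k C => symexp_right C k) rightE muE Q0levy Q0j0
  (fun a j => (cross_delta A a j).1) (fun a j => (cross_delta A a j).2) B.
exact: (null_cross_phase phiID (phi_right B) (phi_left A) c0 b0).
Qed.

Lemma mixing_of_components (theta1 theta2 : 'rV[R]_(m * d)) :
  ccvg (fun k => cintegral P (fun w =>
      cexp ('i * (dotv theta1 (stack X s w))%:C
            + 'i * (dotv theta2 (stack X (fun a => p a + t k) w))%:C)))
    (cintegral P (fun w => cexp ('i * (dotv theta1 (stack X s w))%:C))
     * cintegral P (fun w => cexp ('i * (dotv theta2 (stack X p w))%:C))).
Proof.
have dotE theta (r : 'I_m -> 'rV[R]_l) w : dotv theta (stack X r w) =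
    \sum_a dotv (row a (vec_mx theta)) (X (r a) w).
  by rewrite -dotv_stack vec_mxK.
have E1 : cintegral P (fun w => cexp ('i * (dotv theta1 (stack X s w))%:C)) =
    cis_mean P (dotL (vec_mx theta1)).
  by congr cintegral; apply/funext => w; rewrite dotE.
have E2 : cintegral P (fun w => cexp ('i * (dotv theta2 (stack X p w))%:C)) =
    cis_mean P (fun w => \sum_a dotv (row a (vec_mx theta2)) (X (p a) w)).
  by congr cintegral; apply/funext => w; rewrite dotE.
have E12 k : cintegral P (fun w =>
      cexp ('i * (dotv theta1 (stack X s w))%:C
            + 'i * (dotv theta2 (stack X (fun a => p a + t k) w))%:C)) =
    phi k (right (vec_mx theta2) + left (vec_mx theta1)).
  congr cintegral; apply/funext => w.
  rewrite -mulrDr -rmorphD/= dotvDl dot_left dot_right !dotE.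
  by rewrite addrC.
apply/ccvgP; have := null_joint (vec_mx theta1) (vec_mx theta2).
by congr null_seq; apply/funext => k; rewrite E1 E2 E12.
Qed.

End mixing_of_components.

Lemma lattice_null (R : realType) d (Q : {measure set 'rV[R]_d -> \bar R})
    (j : 'I_d) :
  Q [set x : 'rV[R]_d | exists (j : 'I_d) (z : int),
       x ord0 j = 2 * pi * z%:~R] = 0%E ->
  Q [set x : 'rV[R]_d | cos (dotv (delta_mx ord0 j) x) = 1] = 0%E.
Proof.
have mN i : measurable [set x : 'rV[R]_d | cos (dotv (delta_mx ord0 i) x) = 1].
  have [+ _] := bm_cos_dotv (delta_mx ord0 i : 'rV[R]_d).
  by move=> /(_ measurableT [set 1] (measurable_set1 _)); rewrite setTI.
have -> : [set x : 'rV[R]_d | exists (j : 'I_d) (z : int),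
      x ord0 j = 2 * pi * z%:~R] =
    \bigcup_(i in [set: 'I_d]) [set x | cos (dotv (delta_mx ord0 i) x) = 1].
  apply/seteqP; split=> x.
    by move=> [i [z xz]]; exists i => //=; rewrite dotv_delta; apply/cos_eq1; exists z.
  by move=> [i _ /=]; rewrite dotv_delta => /cos_eq1[z xz]; exists i, z.
move=> Q0; apply/eqP; rewrite -measure_le0 -Q0; apply: le_measure.
- by rewrite inE.
- by rewrite inE; apply: fin_bigcup_measurable.
- by move=> x xj; exists j.
Qed.

Theorem theorem2p2 (R : realType) (disp : measure_display)
    (Omega : measurableType disp) (P : probability Omega R)
    (l d : nat) (hl : (0 < l)%N) (hd : (0 < d)%N)
    (X : 'rV[R]_l -> {RV P >-> 'rV[R]_d})
    (Xstat : strictly_stationary X) (XID : infinitely_divisible_field X)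
    (Q0 : {measure set 'rV[R]_d -> \bar R})
    (Q0levy : is_levy_measure (distribution P (X 0)) Q0)
    (Q0lattice : Q0 [set x : 'rV[R]_d | exists (j : 'I_d) (z : int),
                       x ord0 j = 2 * pi * z%:~R] = 0%E) :
  mixing X <->
  (forall (j k : 'I_d) (t : nat -> 'rV[R]_l), escaping t ->
    ccvg
      (fun n => cintegral P (fun w =>
        cexp ('i%C * (X (t n) w ord0 j - X 0 w ord0 k)%:C)))
      (cintegral P (fun w => cexp ('i%C * (X 0 w ord0 j)%:C))
       * cintegral P (fun w => cexp (- 'i%C * (X 0 w ord0 k)%:C)))).
Proof.
split=> [Xmix j k t tesc|corr m s p theta1 theta2 t tesc].
- have dot1 (v : 'rV[R]_d) (r : 'I_1 -> 'rV[R]_l) w :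
      dotv (mxvec v) (stack X r w) = dotv v (X (r ord0) w).
    rewrite dotv_stack big_ord1; congr dotv; apply/rowP => i; rewrite mxE.
    by congr (v _ _); exact: val_inj.
  (* Mixing is applied with m = 1 and both times 0: e_j moves along t, and -e_k stays. *)
  pose thj : 'rV[R]_(1 * d) := mxvec (delta_mx ord0 j : 'rV[R]_d).
  pose thk : 'rV[R]_(1 * d) := mxvec (- delta_mx ord0 k : 'rV[R]_d).
  have := Xmix 1 (fun=> 0) (fun=> 0) thk thj t tesc.
  have -> : (fun n => cintegral P (fun w =>
      cexp ('i * (dotv thk (stack X (fun=> 0) w))%:C +
        'i * (dotv thj (stack X (fun=> 0 + t n) w))%:C))) =
      (fun n => cintegral P (fun w =>
        cexp ('i * (X (t n) w ord0 j - X 0 w ord0 k)%:C))).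
    apply/funext => n; congr cintegral; apply/funext => w.
    by rewrite /thj /thk !dot1 dotvNl !dotv_delta add0r -mulrDr -rmorphD/= addrC.
  have -> : cintegral P (fun w =>
      cexp ('i * (dotv thk (stack X (fun=> 0) w))%:C)) =
      cintegral P (fun w => cexp (- 'i * (X 0 w ord0 k)%:C)).
    congr cintegral; apply/funext => w.
    by rewrite /thk dot1 dotvNl dotv_delta rmorphN/= mulrN mulNr.
  have -> : cintegral P (fun w =>
      cexp ('i * (dotv thj (stack X (fun=> 0) w))%:C)) =
      cintegral P (fun w => cexp ('i * (X 0 w ord0 j)%:C)).
    by congr cintegral; apply/funext => w; rewrite /thj dot1 dotv_delta.
  by rewrite mulrC.
- apply: (mixing_of_components Xstat XID Q0levy
    (lattice_null (Ordinal hd) Q0lattice)) => // {m s p theta1 theta2 t tesc} j t.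
  (* For j = k the limit is a number times its conjugate, c1^2 + c2^2, and the real part of the
     difference is dominated by its modulus. *)
  move=> /(corr j j)/ccvgP/null_seq_squeeze; apply => n.
  rewrite [X in _ <= X]ger0_norm ?normc_ge0//.
  apply: le_trans (normr_Re_le _).
  have -> : cintegral P (fun w => cexp (- 'i * (X 0 w ord0 j)%:C)) =
      cis_mean P (fun w => - X 0 w ord0 j).
    by congr cintegral; apply/funext => w; rewrite rmorphN/= mulrN mulNr.
  rewrite -!/(cis_mean P _) !cis_meanE.
  under [\int[P]_w cos (- _)]eq_Rintegral do rewrite cosN.
  have -> : \int[P]_w sin (- X 0 w ord0 j) = - \int[P]_w sin (X 0 w ord0 j).
    rewrite -mulN1r -ERZ; first by under [RHS]eq_Rintegral do rewrite mulN1r -sinN.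
    by apply: bm_sin; exact: measurable_component.
  simpc => /=; rewrite le_eqVlt; apply/orP; left; apply/eqP.
  by congr Num.norm; ring.
Qed.
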